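(* Suppose there is a universal constant $1<\gamma<\infty$ such that for every $q\times p^2$ real matrix $\mathbf{B}$ (any $q$) we have $\operatorname{E}\|\mathbf{B}\mathbf{u}_{ij}\|^4\le \gamma\,\{\operatorname{E}(\|\mathbf{B}\mathbf{u}_{ij}\|^2)\}^2$ for all $j=1,\ldots,n_i$, $i=1,2$. Then $$\left\|\mathcal{L}(\tilde T_{n,p,0})-\mathcal{L}(\tilde T^*_{n,p,0})\right\|_3\le \frac{(2\gamma)^{3/2}}{3^{1/4}}\left(\frac{1}{n_1}+\frac{1}{n_2}\right)^{1/2}.$$
   Context: Setting. There are two independent samples of random vectors in $\mathbb{R}^p$: for $i=1,2$, $\mathbf{y}_{i1},\ldots,\mathbf{y}_{in_i}$ are i.i.d. with mean vector $\boldsymbol\mu_i=\mathbf{0}$ and covariance matrix $\boldsymbol\Sigma_i$; $n=n_1+n_2$ with $n_1,n_2>2$. For a matrix $\mathbf{A}$, $vec(\mathbf{A})$ is the column vector obtained by stacking the columns of $\mathbf{A}$. Put $$\mathbf{w}_{ij}=vec(\mathbf{y}_{ij}\mathbf{y}_{ij}^\top)=\mathbf{y}_{ij}\otimes\mathbf{y}_{ij}\in\mathbb{R}^{p^2},\qquad \mathbf{u}_{ij}=\mathbf{w}_{ij}-vec(\boldsymbol\Sigma_i),$$ so that $\operatorname{E}(\mathbf{u}_{ij})=\mathbf{0}$, and let $\boldsymbol\Omega_i=\operatorname{Cov}(\mathbf{u}_{ij})$ ($p^2\times p^2$), assumed to exist. $\|\cdot\|$ is the Euclidean norm of a vector. For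 a collection $\mathcal{U}=\{\mathbf{u}_{ij}: j=1,\ldots,n_i;\ i=1,2\}$ define $$Q(\mathcal{U})=\frac{2}{n_1(n_1-1)}\sum_{1\le i<j\le n_1}\mathbf{u}_{1i}^\top\mathbf{u}_{1j}+\frac{2}{n_2(n_2-1)}\sum_{1\le i<j\le n_2}\mathbf{u}_{2i}^\top\mathbf{u}_{2j}-\frac{2}{n_1n_2}\sum_{i=1}^{n_1}\sum_{j=1}^{n_2}\mathbf{u}_{1i}^\top\mathbf{u}_{2j}.$$ Let $T_{n,p,0}=Q(\mathcal{U})$ for the vectors $\mathbf{u}_{ij}$ above. Let $T^*_{n,p,0}=Q(\mathcal{U}^* )$, where $\mathcal{U}^*=\{\mathbf{u}^*_{ij}\}$ consists of mutually independent vectors, independent of $\mathcal{U}$, with $\mathbf{u}^*_{i1},\ldots,\mathbf{u}^*_{in_i}$ i.i.d. $N_{p^2}(\mathbf{0},\boldsymbol\Omega_i)$, $i=1,2$. Both $T_{n,p,0}$ and $T^*_{n,p,0}$ have mean $0$ and variance $$\sigma_T^2=2\left\{\frac{\operatorname{tr}(\boldsymbol\Omega_1^2)}{n_1(n_1-1)}+\frac{2\operatorname{tr}(\boldsymbol\Omega_1\boldsymbol\Omega_2)}{n_1n_2}+\frac{\operatorname{tr}(\boldsymbol\Omega_2^2)}{n_2(n_2-1)}\right\},$$ with $\sigma_T>0$ understood. Define $\tilde T_{n,p,0}=T_{n,p,0}/\sigma_T$ and $\tilde T^*_{n,p,0}=T^*_{n,p,0}/\sigma_T$. $\mathcal{L}(y)$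 denotes the distribution of a random variable $y$. For a finite signed measure $\nu$ on $\mathbb{R}$, $\|\nu\|_3=\sup_f\int_{\mathbb{R}}f(x)\,\nu(dx)$, where the supremum is over all bounded functions $f:\mathbb{R}\to\mathbb{R}$ with continuous derivatives up to order $3$ such that $\sup_{x\in\mathbb{R}}|f^{(r)}(x)|\le 1$ for $r=1,2,3$. *)

(* Defs.v *)
From HB Require Import structures.
From mathcomp Require Import all_boot all_order all_algebra.
From mathcomp Require Import all_classical all_reals all_analysis measurable_realfun.

Set Implicit Arguments.
Unset Strict Implicit.
Unset Printing Implicit Defensive.

Import Order.TTheory GRing.Theory Num.Theory.
Import numFieldNormedType.Exports.

Local Open Scope classical_set_scope.
Local Open Scope ring_scope.

(* Matrices carry the sigma-algebra generated by their entries, i.e. the Borel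
   sigma-algebra of R^(m x n). *)

Definition measure_matrix_display : measure_display -> measure_display.
Proof. exact. Qed.

Section measurable_matrix.
Context d (V : measurableType d) (m n : nat).

Definition g_sigma_entries : set_system 'M[V]_(m, n) :=
  <<s \bigcup_(ij in [set: 'I_m * 'I_n])
        preimage_set_system setT (fun A : 'M[V]_(m, n) => A ij.1 ij.2)
          measurable >>.

Let mx_set0 : g_sigma_entries set0.
Proof. exact: sigma_algebra0. Qed.

Let mx_setC A : g_sigma_entries A -> g_sigma_entries (~` A).
Proof. exact: sigma_algebraC. Qed.

Let mx_bigcup (F : (set 'M[V]_(m, n))^nat) : (forall i, g_sigma_entries (F i)) ->
  g_sigma_entries (\bigcup_i (F i)).
Proof. exact: sigma_algebra_bigcup. Qed.

HB.instance Definition _ := @isMeasurable.Build (measure_matrix_display d)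
  'M[V]_(m, n) g_sigma_entries mx_set0 mx_setC mx_bigcup.

Lemma measurable_entry i j :
  measurable_fun [set: 'M[V]_(m, n)] (fun A : 'M[V]_(m, n) => A i j).
Proof.
move=> _ Y mY; rewrite setTI; apply: sub_sigma_algebra => /=.
by exists (i, j) => //; exists Y => //; rewrite setTI.
Qed.

Lemma measurable_matrixP d' (T : measurableType d') (X : T -> 'M[V]_(m, n)) :
  (forall i j, measurable_fun [set: T] (fun w => X w i j)) ->
  measurable_fun [set: T] X.
Proof.
move=> mX; apply: measurability; first reflexivity.
move=> _ [_ [[i j] _ [B mB <-] <-]].
by rewrite !setTI; have := mX i j measurableT B mB; rewrite setTI.
Qed.

End measurable_matrix.

Section linear_algebra.
Context {R : realType}.

Definition dot (m : nat) (u v : 'cV[R]_m) : R := (u^T *m v) 0 0.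

(* The norm `|_| of matrices in the library is the sup norm, hence: *)
Definition enorm (m : nat) (u : 'cV[R]_m) : R := Num.sqrt (dot u u).

(* mxvec reads a matrix row by row, hence the transpose *)
Definition vec (m n : nat) (A : 'M[R]_(m, n)) : 'cV[R]_(n * m) := (mxvec A^T)^T.

Lemma dotE (m : nat) (u v : 'cV[R]_m) : dot u v = \sum_k u k 0 * v k 0.
Proof. by rewrite /dot mxE; apply: eq_bigr => k _; rewrite mxE. Qed.

End linear_algebra.

Section random_vectors.
Context d (T : measurableType d) (R : realType) (P : probability T R).

Definition has_mean (m : nat) (X : {RV P >-> 'cV[R]_m}) (mu : 'cV[R]_m) : Prop :=
  forall k, (fun w => X w k 0) \in Lfun P 1 /\
            ('E_P[(fun w => X w k 0)%R])%E = (mu k 0)%:E.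

Definition has_cov (m : nat) (X : {RV P >-> 'cV[R]_m}) (S : 'M[R]_m) : Prop :=
  (forall k, (fun w => X w k 0) \in Lfun P 2%:E) /\
  forall k l, covariance P (fun w => X w k 0) (fun w => X w l 0) = (S k l)%:E.

(* N(m, v), v being the variance; normal_prob takes the standard deviation and
   is not the Dirac measure when this is 0. *)
Definition normal_law (m v : R) (A : set R) : \bar R :=
  if v == 0 then \d_m A else normal_prob m (Num.sqrt v) A.

(* Possibly degenerate N_m(mu, S): all linear combinations of the coordinates
   are univariate normal. *)
Definition gaussian_vector (m : nat) (X : {RV P >-> 'cV[R]_m}) (mu : 'cV[R]_m)
    (S : 'M[R]_m) : Prop :=
  forall (a : 'cV[R]_m) (A : set R), measurable A ->
    P ((fun w => dot a (X w)) @^-1` A) = normal_law (dot a mu) (dot a (S *m a)) A.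

Section families.
Context d' (V : measurableType d').

Definition identically_distributed (I : Type) (X : I -> {RV P >-> V}) : Prop :=
  forall i j (A : set V), measurable A ->
    distribution P (X i) A = distribution P (X j) A.

Definition mutually_independent (I : finType) (X : I -> {RV P >-> V}) : Prop :=
  forall (J : {set I}) (A : I -> set V), (forall i, measurable (A i)) ->
    P (\bigcap_(i in [set i | i \in J]) X i @^-1` A i) =
    (\prod_(i in J) P (X i @^-1` A i))%E.

Definition sigma_family (I : Type) (X : I -> {RV P >-> V}) : set_system T :=
  <<s \bigcup_(i in [set: I]) preimage_set_system setT (X i) measurable >>.

Definition independent_families (I J : Type) (X : I -> {RV P >-> V})
    (Y : J -> {RV P >-> V}) : Prop :=
  forall A B, sigma_family X A -> sigma_family Y B ->
    P (A `&` B) = (P A * P B)%E.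

Definition pool (n1 n2 : nat) (X : 'I_n1 -> {RV P >-> V})
    (Y : 'I_n2 -> {RV P >-> V}) (k : 'I_n1 + 'I_n2) : {RV P >-> V} :=
  match k with inl i => X i | inr j => Y j end.

End families.

Section udev.
Context (p : nat) (S : 'M[R]_p) (y : {RV P >-> 'cV[R]_p}).

Definition udev (w : T) : 'cV[R]_(p * p) := vec (y w *m (y w)^T) - vec S.

Let measurable_udev : measurable_fun [set: T] udev.
Proof.
apply: measurable_matrixP => k j; case/mxvec_indexP: k => a b.
rewrite [X in measurable_fun _ X](_ : _ = fun w =>
  y w b 0 * y w a 0 - S b a); last first.
  apply/funext => w; rewrite /udev /vec !mxE ord1 !mxvecE !mxE big_ord1.
  by rewrite !mxE.
have my c : measurable_fun [set: T] (fun w => y w c 0).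
  apply: (measurableT_comp (measurable_entry c 0)).
  exact: measurable_funPT.
by apply: measurable_funB => //; exact: measurable_funM.
Qed.

HB.instance Definition _ := isMeasurableFun.Build _ _ _ _ udev measurable_udev.

End udev.

Section statistic.
Context (m n1 n2 : nat).

Definition Qstat (u1 : 'I_n1 -> 'cV[R]_m) (u2 : 'I_n2 -> 'cV[R]_m) : R :=
  2 / (n1%:R * (n1%:R - 1)) *
    (\sum_(i < n1) \sum_(j < n1 | (i < j)%N) dot (u1 i) (u1 j))
  + 2 / (n2%:R * (n2%:R - 1)) *
    (\sum_(i < n2) \sum_(j < n2 | (i < j)%N) dot (u2 i) (u2 j))
  - 2 / (n1%:R * n2%:R) *
    (\sum_(i < n1) \sum_(j < n2) dot (u1 i) (u2 j)).

Definition sigmaT (Omega1 Omega2 : 'M[R]_m) : R :=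
  Num.sqrt (2 * (\tr (Omega1 *m Omega1) / (n1%:R * (n1%:R - 1))
               + 2 * \tr (Omega1 *m Omega2) / (n1%:R * n2%:R)
               + \tr (Omega2 *m Omega2) / (n2%:R * (n2%:R - 1)))).

Definition Tstd (Omega1 Omega2 : 'M[R]_m) (U1 : 'I_n1 -> {RV P >-> 'cV[R]_m})
    (U2 : 'I_n2 -> {RV P >-> 'cV[R]_m}) (w : T) : R :=
  Qstat (U1 ^~ w) (U2 ^~ w) / sigmaT Omega1 Omega2.

Context (Omega1 Omega2 : 'M[R]_m) (U1 : 'I_n1 -> {RV P >-> 'cV[R]_m})
  (U2 : 'I_n2 -> {RV P >-> 'cV[R]_m}).

Let measurable_dot (X Y : {RV P >-> 'cV[R]_m}) :
  measurable_fun [set: T] (fun w => dot (X w) (Y w)).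
Proof.
under eq_fun do rewrite dotE.
have mX (Z : {RV P >-> 'cV[R]_m}) k : measurable_fun [set: T] (fun w => Z w k 0).
  apply: (measurableT_comp (measurable_entry k 0)).
  exact: measurable_funPT.
by apply: measurable_sum => k; exact: measurable_funM.
Qed.

Let measurable_Tstd : measurable_fun [set: T] (Tstd Omega1 Omega2 U1 U2).
Proof.
rewrite /Tstd /Qstat; apply: measurable_funM => //.
apply: measurable_funB.
  have half n (U : 'I_n -> {RV P >-> 'cV[R]_m}) : measurable_fun [set: T]
      (fun w => \sum_(i < n) \sum_(j < n | (i < j)%N) dot (U i w) (U j w)).
    apply: measurable_sum => i.
    rewrite (_ : (fun _ => _) = fun w =>
      \sum_(j < n) if (i < j)%N then dot (U i w) (U j w) else 0).
      by apply: measurable_sum => j; case: (i < j)%N.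
    by apply/funext => w; rewrite big_mkcond.
  by apply: measurable_funD; apply: measurable_funM => //; exact: half.
apply: measurable_funM => //.
by apply: measurable_sum => i; apply: measurable_sum => j.
Qed.

HB.instance Definition _ := isMeasurableFun.Build _ _ _ _
  (Tstd Omega1 Omega2 U1 U2) measurable_Tstd.

End statistic.

Definition law_diff (X Y : {RV P >-> R}) : {charge set R -> \bar R} :=
  cadd (charge_of_finite_measure (distribution P X))
       (copp (charge_of_finite_measure (distribution P Y))).

End random_vectors.

Arguments has_mean {d T R} P {m}.
Arguments has_cov {d T R} P {m}.
Arguments gaussian_vector {d T R} P {m}.
Arguments identically_distributed {d T R} P {d' V I}.
Arguments mutually_independent {d T R} P {d' V I}.
Arguments independent_families {d T R} P {d' V I J}.
Arguments law_diff {d T R} P.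

Section smooth_norm.
Context {R : realType}.
Implicit Types (nu : {charge set R -> \bar R}) (f : R -> R).

Definition hahn_pos nu : set R := projT1 (cid (Hahn_decomposition nu)).

Definition hahn_neg nu : set R := projT1 (cid (projT2 (cid (Hahn_decomposition nu)))).

Lemma hahnP nu : hahn_decomposition nu (hahn_pos nu) (hahn_neg nu).
Proof. exact: (projT2 (cid (projT2 (cid (Hahn_decomposition nu))))). Qed.

(* The integral w.r.t. a signed measure is taken along its Jordan decomposition,
   which does not depend on the choice of the Hahn decomposition. *)
Definition charge_integral nu f : \bar R :=
  (\int[jordan_pos (hahnP nu)]_x (f x)%:E - \int[jordan_neg (hahnP nu)]_x (f x)%:E)%E.

Definition test_function3 f : Prop :=
  [/\ (exists M : R, forall x, `|f x| <= M),
      forall r, (r < 3)%N -> forall x, derivable (f^`(r)%classic) x 1,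
      forall r, (r <= 3)%N -> continuous (f^`(r)%classic) &
      forall r, (1 <= r <= 3)%N -> forall x, `|(f^`(r)%classic) x| <= 1].

Definition norm3 nu : \bar R :=
  ereal_sup [set charge_integral nu f | f in test_function3].

End smooth_norm.

(* Main.v *)
Require Import Defs.
From mathcomp Require Import all_boot all_order all_algebra.
From mathcomp Require Import all_classical all_reals all_analysis measurable_realfun.
From HB Require Import structures.
From mathcomp Require Import ring lra.

(** The law of the statistic is compared with its Gaussian counterpart by
    Lindeberg's replacement argument: the vectors u are exchanged for Gaussian
    vectors one at a time, and every exchange costs a third-order Taylor
    remainder.

    As a function of the k-th vector z_k the statistic is R + S . z_k, where the
    slope S and the rest R are functions of the other vectors, hence independent
    of z_k (mutually_independent_indep). Conditionally on (S, R), the two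
    candidates for z_k produce scalars S . z_k with the same mean 0 and the same
    variance v = S^T Omega_k S, so that the mean of the test function moves by at
    most one sixth of the sum of their third absolute moments (expect_taylor3).
    These are at most sqrt gamma v^(3/2) for the data, by interpolation between
    the second and fourth moments, and equal to sqrt (8 / pi) v^(3/2) for the
    Gaussian vector.

    It remains to bound E v^(3/2). Factoring Omega_k = B^T B (psd_factor) makes v
    a sum of squares of linear functionals of S. Each of these is a sum of
    independent centred variables, and its fourth moment is at most M times its
    squared variance, with M = max (gamma, 3) (centered4_sum). This gives
    E v^2 <= M V_k^2 and E v^(3/2) <= sqrt M V_k^(3/2), where V_k = E v
    (expect_quad_form_three_halves). The V_k are constant on each sample and add
    up to 2 (slope_var_total), so the sum of V_k^(3/2) is at most
    2^(3/2) (1/n1 + 1/n2)^(1/2) (sum_three_halves_le).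

    The total is (sqrt gamma + sqrt (8 / pi)) sqrt M / 6 times this sum, and the
    constant is at most gamma^(3/2) / 3^(1/4) (lindeberg_constant). For gamma
    close to 1 there is little room: bounding the third moment of the standard
    Gaussian by interpolation, that is by sqrt 3, would be too coarse, and its
    value sqrt (8 / pi) is needed together with the estimate pi >= 3.06. *)

Set Implicit Arguments.
Unset Strict Implicit.
Unset Printing Implicit Defensive.

Import Order.TTheory GRing.Theory Num.Theory.
Import numFieldNormedType.Exports.

Local Open Scope classical_set_scope.
Local Open Scope ring_scope.

(** * Taylor expansion to third order *)

Section taylor.
Context {R : realType}.
Implicit Types (f g h : R -> R) (x t C : R).

Lemma is_derive_pow n t :
  is_derive t (1 : R) (fun x : R => x ^+ n) (n%:R * t ^+ n.-1).
Proof.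
have := is_deriveX n (is_derive_id t (1 : R)).
rewrite /GRing.scale/= mulr1.
by rewrite (_ : id ^+ n = (fun x : R => x ^+ n)) // exprfctE.
Qed.

Lemma le_pow_of_derive_le g C n : (forall x, derivable g x 1) -> g 0 = 0 ->
  (forall x, 0 <= x -> derive1 g x <= C * x ^+ n) ->
  forall x, 0 <= x -> g x <= C * x ^+ n.+1 / n.+1%:R.
Proof.
move=> dg g0 g'le x x0.
pose h : R -> R := (C / n.+1%:R) \*: (fun x : R => x ^+ n.+1) - g.
have dh t : is_derive t 1 h (C * t ^+ n - derive1 g t).
  have dgt : is_derive t 1 g (derive1 g t) by rewrite derive1E; exact: derivableP.
  rewrite (_ : C * t ^+ n = (C / n.+1%:R) *: (n.+1%:R * t ^+ n)).
    exact: (is_deriveB (is_deriveZ _ (is_derive_pow n.+1 t)) dgt).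
  by rewrite /GRing.scale/= mulrA divfK.
have hx : h 0 <= h x.
  have ch : continuous h.
    by move=> t; apply/differentiable_continuous/derivable1_diffP.
  apply: (@ger0_derive1_le_cc _ h 0 x) => //; rewrite ?in_itv/= ?lexx ?x0//.
  - move=> t /[!in_itv]/= /andP[t0 _]; rewrite derive1E derive_val subr_ge0.
    exact/g'le/ltW.
  - exact: continuous_subspaceT.
move: hx; rewrite /h !fctE/= /GRing.scale/= expr0n/= mulr0 g0 subr0 subr_ge0.
by rewrite mulrAC.
Qed.

(** The one-sided bound on the half-line is applied to g, - g and their
    reflections x |-> g (- x). *)
Lemma norm_le_pow_of_derive_le g C n : (forall x, derivable g x 1) -> g 0 = 0 ->
  (forall x, `|derive1 g x| <= C * `|x| ^+ n) ->
  forall x, `|g x| <= C * `|x| ^+ n.+1 / n.+1%:R.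
Proof.
have key h : (forall x, derivable h x 1) -> h 0 = 0 ->
    (forall x, `|derive1 h x| <= C * `|x| ^+ n) ->
    forall x, 0 <= x -> `|h x| <= C * x ^+ n.+1 / n.+1%:R.
  move=> dh h0 h'le x x0; rewrite ler_norml lerNl; apply/andP; split; last first.
    apply: le_pow_of_derive_le => // t t0.
    by rewrite (le_trans (ler_norm _))// -{2}(ger0_norm t0).
  apply: (@le_pow_of_derive_le (- h)) => // [t||t t0].
  - exact: derivableN.
  - by rewrite fctE h0 oppr0.
  - rewrite derive1E deriveN// -derive1E.
    by rewrite (le_trans (ler_norm _))// normrN -{2}(ger0_norm t0).
move=> dg g0 g'le x; have [x0|/ltW x0] := leP 0 x.
  by rewrite [X in C * X ^+ _]ger0_norm//; exact: key.
have dN (t : R) : is_derive t 1 (g \o -%R) (- derive1 g (- t)).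
  have dgt : is_derive (- t) 1 g (derive1 g (- t)).
    by rewrite derive1E; exact: derivableP.
  have := is_derive1_comp dgt (is_deriveN (is_derive_id t (1 : R))).
  by rewrite mulrN1.
have := @key (g \o -%R) _ _ _ (- x).
rewrite /= opprK (ler0_norm x0) oppr_ge0; apply => //.
- by rewrite oppr0.
- by move=> t; rewrite derive1E derive_val normrN (le_trans (g'le _))// normrN.
Qed.

(** The bound 1 on the third derivative is integrated three times. *)
Lemma taylor3 f q t : (forall r, (r < 3)%N -> forall x, derivable (derive1n r f) x 1) ->
  (forall x, `|derive1n 3 f x| <= 1) ->
  `|f (q + t) - (f q + derive1n 1 f q * t + derive1n 2 f q * (t ^+ 2 / 2))|
    <= `|t| ^+ 3 / 6.
Proof.
move=> df f3.
have dshift r (s : R) : (r < 3)%N ->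
    is_derive s (1 : R) (fun s => derive1n r f (q + s)) (derive1n r.+1 f (q + s)).
  move=> r3; have dfs : is_derive (q + s) 1 (derive1n r f) (derive1n r.+1 f (q + s)).
    by rewrite derive1nS derive1E; apply: derivableP; exact: df.
  have := is_derive1_comp dfs (is_deriveD (is_derive_cst q s (1 : R)) (is_derive_id s 1)).
  by rewrite add0r mulr1.
have lin a (s : R) : is_derive s 1 (fun s => a * s) a.
  have := is_deriveZ a (is_derive_id s (1 : R)).
  by rewrite /GRing.scale/= mulr1.
have quad a (s : R) : is_derive s 1 (fun s => a * (s ^+ 2 / 2)) (a * s).
  have := is_deriveZ (a / 2) (is_derive_pow 2 s).
  rewrite /GRing.scale/= expr1 (mulrA (a / 2)) divfK// => H.
  have <- : (a / 2) \*: (fun x : R => x ^+ 2) = (fun x => a * (x ^+ 2 / 2)) => //.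
  by apply/funext => x; rewrite /GRing.scale/= mulrA mulrAC.
set a := f q; set b := derive1n 1 f q; set c := derive1n 2 f q.
pose g2 (s : R) := derive1n 2 f (q + s) - c.
pose g1 (s : R) := derive1n 1 f (q + s) - (b + c * s).
pose g0 (s : R) := f (q + s) - (a + b * s + c * (s ^+ 2 / 2)).
have d2 (s : R) : is_derive s 1 g2 (derive1n 3 f (q + s)).
  have := is_deriveB (@dshift 2 s isT) (is_derive_cst c s (1 : R)).
  by rewrite subr0.
have d1 (s : R) : is_derive s 1 g1 (g2 s).
  have := is_deriveB (@dshift 1 s isT) (is_deriveD (is_derive_cst b s (1 : R)) (lin c s)).
  by rewrite add0r.
have d0 (s : R) : is_derive s 1 g0 (g1 s).
  have := is_deriveB (@dshift 0 s isT)
    (is_deriveD (is_deriveD (is_derive_cst a s (1 : R)) (lin b s)) (quad c s)).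
  by rewrite add0r.
have B2 (s : R) : `|g2 s| <= `|s|.
  have := @norm_le_pow_of_derive_le g2 1 0 _ _ _ s.
  rewrite expr1 mul1r divr1; apply => //; first by rewrite /g2 addr0 subrr.
  by move=> x; rewrite derive1E derive_val expr0 mulr1.
have B1 (s : R) : `|g1 s| <= 2^-1 * `|s| ^+ 2.
  have := @norm_le_pow_of_derive_le g1 1 1 _ _ _ s.
  rewrite mul1r mulrC; apply => //; first by rewrite /g1 addr0 mulr0 addr0 subrr.
  by move=> x; rewrite derive1E derive_val mul1r expr1.
have := @norm_le_pow_of_derive_le g0 2^-1 2 _ _ _ t.
rewrite (_ : 2^-1 * `|t| ^+ 3 / 3 = `|t| ^+ 3 / 6); last by field.
apply => //.
  by rewrite /g0 addr0 expr0n/= mul0r !mulr0 !addr0 subrr.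
by move=> x; rewrite derive1E derive_val.
Qed.

End taylor.

(** * Numerical constants *)

Section constants.
Context {R : realType}.

Lemma sin_le (x : R) : 0 <= x -> sin x <= x.
Proof.
move=> x0; rewrite -[leRHS]mul1r -[x in leRHS]expr1 -[leRHS]divr1.
apply: le_pow_of_derive_le => //; first exact: sin0.
by move=> t _; rewrite derive1E derive_val expr0 mulr1 cos_le1.
Qed.

(** The inequality sin x <= x at x = pi / 8, where sin x is known from
    cos (pi / 4) by the double-angle formula. *)
Lemma pi_ge306 : 306 / 100 <= pi :> R.
Proof.
pose s : R := sin (pi / 8); pose c : R := cos (pi / 4).
have p0 := @pi_gt0 R.
have c0 : 0 < c by rewrite cos_gt0_pihalf//; lra.
have c2 : c ^+ 2 = 1 / 2.
  have := tan_piquarter R; rewrite /tan -/c => tE.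
  have sE : sin (pi / 4) = c.
    by apply: (divIf (lt0r_neq0 c0)); rewrite tE divff// gt_eqF.
  by have := cos2Dsin2 (pi / 4 : R); rewrite sE -/c; lra.
have cs : c = 1 - s ^+ 2 *+ 2.
  rewrite /c (_ : pi / 4 = (pi / 8) *+ 2); last by rewrite -mulr_natr; field.
  by rewrite cos_mulr2n cos2sin2 -/s; lra.
have s0 : 0 <= s by apply: sin_ge0_pi; apply/andP; split; lra.
have sp : s <= pi / 8 by apply: sin_le; lra.
have cle : c <= 7072 / 10000 by nra.
nra.
Qed.

Lemma sqrt_8_over_pi_le : Num.sqrt (8 / pi) <= 1617 / 1000 :> R.
Proof.
have p := pi_ge306; have p0 := @pi_gt0 R.
rewrite -[leRHS]ger0_norm; last lra.
rewrite -sqrtr_sqr ler_wsqrtr// ler_pdivrMr//; nra.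
Qed.

(** Here g stands for sqrt gamma, w for 3^(1/4), so that max (g, w^2) is
    sqrt (max (gamma, 3)), and c for the third absolute moment of the standard
    Gaussian. Only g close to 1 is critical: at g = 1 the two sides are about
    0.756 and 0.760 when c = 1617/1000. *)
Lemma lindeberg_constant (g w c : R) : 1 <= g -> 0 <= w -> w ^+ 4 = 3 ->
  0 <= c -> c <= 1617 / 1000 -> (g + c) * Num.max g (w ^+ 2) / 6 <= g ^+ 3 / w.
Proof.
move=> g1 w0 w4 c0 c1.
have w1 : 263 / 200 <= w.
  by rewrite -(@ler_pXn2r _ 4 isT) ?nnegrE ?w4; lra.
have w3 : w ^+ 3 <= 229 / 100.
  rewrite (_ : w ^+ 3 = w ^+ 4 / w); last by field; lra.
  by rewrite w4 ler_pdivrMr; lra.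
have w2 : w <= 132 / 100.
  by rewrite -(@ler_pXn2r _ 4 isT) ?nnegrE ?w4; lra.
rewrite ler_pdivlMr; last lra.
have [gw|gw] := leP g (w ^+ 2).
  have -> : (g + c) * w ^+ 2 / 6 * w = (g + c) * w ^+ 3 / 6 by field.
  have : g + c <= 2617 / 1000 * g ^+ 3 by nra.
  nra.
have : (g + c) <= 2617 / 1000 * g by nra.
have : 0 <= (g + c) * g by nra.
nra.
Qed.

End constants.

(** * Gaussian integrals *)

Section gauss_moments.
Context {R : realType}.
Local Notation mu := (@lebesgue_measure R).
Local Notation G := (@gauss_integral_proof.integral0_gauss R).
Local Notation g := (@gauss_fun R).

Lemma cvg_integral0_gauss : G x @[x --> +oo] --> Num.sqrt pi / 2.
Proof.
have : Num.sqrt (G x ^+ 2) @[x --> +oo] --> Num.sqrt (pi / 4).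
  apply: continuous_cvg; first exact: sqrt_continuous.
  exact: gauss_integral_proof.cvg_integral0_gauss_sqr.
rewrite sqrtrM ?pi_ge0// sqrtrV// (_ : 4 = 2 ^+ 2); last by rewrite expr2 -natrM.
rewrite sqrtr_sqr ger0_norm// (_ : (fun _ => Num.sqrt _) = G)//.
apply/funext => r; rewrite sqrtr_sqr ger0_norm//.
exact: gauss_integral_proof.integral0_gauss_ge0.
Qed.

Lemma integrable_gauss_segment (a b : R) : mu.-integrable `[a, b] (EFin \o g).
Proof.
apply: continuous_compact_integrable; first exact: segment_compact.
by apply: continuous_subspaceT; exact: continuous_gauss_fun.
Qed.

Lemma is_derive_integral0_gauss (x : R) : 0 < x -> is_derive x 1 G (g x).
Proof.
move=> x0; have [dG <-] : derivable G x 1 /\ derive1 G x = g x.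
  apply: (@continuous_FTC1 R g (BLeft 0) _ (x + 1)).
  - by rewrite ltrDl.
  - exact: integrable_gauss_segment.
  - by rewrite /= lte_fin.
  - exact: continuous_gauss_fun.
by rewrite derive1E; exact: derivableP.
Qed.

Lemma integral0_gauss_cvg0 : G x @[x --> 0^'+] --> (0 : R).
Proof.
apply: (@squeeze_cvgr _ _ _ _ (cst 0) id); last 2 first.
  exact: cvg_cst.
  exact/cvg_at_right_filter/cvg_id.
near=> x; rewrite gauss_integral_proof.integral0_gauss_ge0/=.
have x0 : 0 < x by near: x; exact: nbhs_right_gt.
rewrite [leRHS](_ : _ = \int[mu]_(t in `[0, x]) (cst 1 t)); last first.
  rewrite Rintegral_cst//= lebesgue_measure_itv/= lte_fin mul1r x0.
  by rewrite /= subr0.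
apply: le_Rintegral => //; first exact: integrable_gauss_segment.
  apply: continuous_compact_integrable; first exact: segment_compact.
  by apply: continuous_subspaceT; exact: cst_continuous.
by move=> t _; exact: gauss_fun_le1.
Unshelve. all: by end_near. Qed.

Lemma cvg_pow_gauss k : (k <= 3)%N -> x ^+ k * g x @[x --> +oo] --> (0 : R).
Proof.
move=> k3; apply: (@squeeze_cvgr _ _ _ _ (cst 0) (fun x => 2 * x^-1)); last 2 first.
- exact: cvg_cst.
- rewrite -[X in _ --> X](mulr0 2); apply: cvgMl_tmp.
  by apply/gtr0_cvgV0; [exact: nbhs_pinfty_gt|exact: cvg_id].
near=> x.
have x1 : 1 <= x by near: x; exact: nbhs_pinfty_ge.
have x0 : 0 < x by lra.
apply/andP; split; first by rewrite /= mulr_ge0 ?exprn_ge0 ?gauss_fun_ge0 ?ltW.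
rewrite (@le_trans _ _ (x ^+ 3 * g x))//.
  by rewrite ler_wpM2r ?gauss_fun_ge0// ler_weXn2l.
rewrite /gauss_fun expRN ler_pdivrMr ?expR_gt0//.
have /(expR_ge1Dxn 1) := sqr_ge0 x.
rewrite (_ : 2`!%:R = 2 :> R)// => h.
rewrite mulrAC ler_pdivlMr//; nra.
Unshelve. all: by end_near. Qed.


(** With g = exp (- x^2) and G its primitive, the function
    a G - (c0 + c1 x + c2 x^2 + c3 x^3) g has derivative f g; suitable
    coefficients give the half-line moments of order 2, 3 and 4 at once. *)
Lemma integral0y_poly_gauss (f : R -> R) (a c0 c1 c2 c3 : R) :
  (forall x, 0 <= x -> 0 <= f x) ->
  (forall x, f x = a - c1 + 2 * (c0 - c2) * x + (2 * c1 - 3 * c3) * x ^+ 2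
                   + 2 * c2 * x ^+ 3 + 2 * c3 * x ^+ 4) ->
  (\int[mu]_(x in `[0%R, +oo[) (f x * g x)%:E = (a * (Num.sqrt pi / 2) + c0)%:E)%E.
Proof.
move=> f0 fE.
pose p x := c0 + c1 * x + c2 * x ^+ 2 + c3 * x ^+ 3.
pose F x := a * G x - p x * g x.
have dp (x : R) : is_derive x 1 p (c1 + 2 * c2 * x + 3 * c3 * x ^+ 2).
  have h1 := is_deriveZ c1 (is_derive_id x (1 : R)).
  have h2 := is_deriveZ c2 (is_derive_pow 2 x).
  have h3 := is_deriveZ c3 (is_derive_pow 3 x).
  have := is_deriveD (is_deriveD (is_deriveD (is_derive_cst c0 x (1 : R)) h1) h2) h3.
  move=> h; refine (is_derive_eq h _).
  by rewrite /GRing.scale/= expr1; ring.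
have dg (x : R) : is_derive x 1 g (- (2 * x) * g x).
  have := @is_derive1_comp _ expR (- (fun x : R => x ^+ 2)) x _ _
    (is_derive_expR (- x ^+ 2)) (is_deriveN (is_derive_pow 2 x)).
  by rewrite expr1 mulrC.
have dF (x : R) : 0 < x -> is_derive x 1 F (f x * g x).
  move=> x0; have := is_deriveB (is_deriveZ a (is_derive_integral0_gauss x0))
    (is_deriveM (dp x) (dg x)).
  move=> h; refine (is_derive_eq h _).
  by rewrite /GRing.scale/= fE /p; ring.
have cg := @continuous_gauss_fun R.
have cp : continuous p.
  by move=> x; apply/differentiable_continuous/derivable1_diffP.
have cf : continuous f.
  rewrite (_ : f = fun x => a - c1 + 2 * (c0 - c2) * x + (2 * c1 - 3 * c3) * x ^+ 2
                   + 2 * c2 * x ^+ 3 + 2 * c3 * x ^+ 4); last exact/funext.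
  move=> x; do 4 ![apply: cvgD;
    last by apply: cvgMl_tmp; do ?[exact: exprn_continuous]; exact: cvg_id].
  exact: cvg_cst.
(* F tends to a sqrt pi / 2 at infinity and F 0 = - c0 *)
rewrite (_ : a * _ + c0 = (a * (Num.sqrt pi / 2) - 0) - F 0); last first.
  rewrite /F /p /gauss_integral_proof.integral0_gauss set_itv1 Rintegral_set1.
  by rewrite /gauss_fun !expr0n/= oppr0 expR0; ring.
rewrite EFinB; apply: (@ge0_continuous_FTC2y _ (fun x => f x * g x) F).
- by move=> x x0; rewrite mulr_ge0 ?f0 ?gauss_fun_ge0.
- by apply: continuous_subspaceT => x; apply: cvgM; [exact: cf|exact: cg].
- apply: cvgB; first by apply: cvgMl_tmp; exact: cvg_integral0_gauss.
  rewrite (_ : (fun x => p x * g x) = fun x =>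
    c0 * (x ^+ 0 * g x) + c1 * (x ^+ 1 * g x) + c2 * (x ^+ 2 * g x)
    + c3 * (x ^+ 3 * g x)); last first.
    by apply/funext => x; rewrite /p expr0 expr1; ring.
  rewrite (_ : 0 = c0 * 0 + c1 * 0 + c2 * 0 + c3 * 0 :> R); last by rewrite !mulr0 !addr0.
  by do 3 ?[apply: cvgD]; apply: cvgMl_tmp; exact: cvg_pow_gauss.
- by move=> x x0; case: (dF x x0).
- rewrite /F {2}/gauss_integral_proof.integral0_gauss set_itv1 Rintegral_set1.
  apply: cvgB; first by apply: cvgMl_tmp; exact: integral0_gauss_cvg0.
  by apply: cvg_at_right_filter; apply: cvgM; [exact: cp|exact: cg].
- by move=> x /[!in_itv]/= /andP[x0 _]; have := dF x x0 => dFx; rewrite derive1E derive_val.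
Qed.

Lemma integralT_poly_gauss (f : R -> R) l : (forall x, 0 <= f x) -> continuous f ->
  (forall x, f (- x) = f x) ->
  (\int[mu]_(x in `[0%R, +oo[) (f x * g x)%:E = l%:E)%E ->
  (\int[mu]_x (f x * g x)%:E = (2 * l)%:E)%E.
Proof.
move=> f0 cf fN fl.
rewrite (@ge0_symfun_integralT _ (fun x => f x * g x)).
- by rewrite -set_itvcy fl.
- by move=> x; rewrite mulr_ge0 ?f0 ?gauss_fun_ge0.
- by move=> x; apply: cvgM; [exact: cf|exact: continuous_gauss_fun].
- by move=> x /=; rewrite fN /gauss_fun sqrrN.
Qed.

Lemma gauss_moment2 : (\int[mu]_x (x ^+ 2 * g x)%:E = (Num.sqrt pi / 2)%:E)%E.
Proof.
rewrite (@integralT_poly_gauss (fun x => x ^+ 2) (1 / 2 * (Num.sqrt pi / 2) + 0)).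
- by congr EFin; field.
- by move=> x; rewrite sqr_ge0.
- by move=> x; exact: exprn_continuous.
- by move=> x; rewrite sqrrN.
- apply: (@integral0y_poly_gauss _ _ _ (1 / 2) 0 0) => x; first by rewrite sqr_ge0.
  by field.
Qed.

Lemma gauss_moment4 : (\int[mu]_x (x ^+ 4 * g x)%:E = (3 * Num.sqrt pi / 4)%:E)%E.
Proof.
rewrite (@integralT_poly_gauss (fun x => x ^+ 4) (3 / 4 * (Num.sqrt pi / 2) + 0)).
- by congr EFin; field.
- by move=> x; rewrite exprn_even_ge0.
- by move=> x; exact: exprn_continuous.
- by move=> x; rewrite exprNn/= -signr_odd/= expr0 mul1r.
- apply: (@integral0y_poly_gauss _ _ _ (3 / 4) 0 (1 / 2)) => x; first by rewrite exprn_even_ge0.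
  by field.
Qed.

Lemma gauss_abs_moment3 : (\int[mu]_x (`|x| ^+ 3 * g x)%:E = 1%:E)%E.
Proof.
rewrite (@integralT_poly_gauss (fun x => `|x| ^+ 3) (0 * (Num.sqrt pi / 2) + 1 / 2)).
- by congr EFin; field.
- by move=> x; rewrite exprn_ge0.
- move=> x; apply: (cvg_comp (fun x : R => `|x|) (fun y : R => y ^+ 3)).
    exact: (@norm_continuous R R^o).
  exact: exprn_continuous.
- by move=> x; rewrite normrN.
- rewrite (_ : (\int[mu]_(x in _) _)%E =
     \int[mu]_(x in `[0%R, +oo[) (x ^+ 3 * g x)%:E)%E; last first.
    apply: eq_integral => x /[!inE]/= /[!in_itv]/= /andP[x0 _].
    by rewrite ger0_norm.
  apply: (@integral0y_poly_gauss (fun x => x ^+ 3) _ _ 0 (1 / 2) 0) => x.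
    by move=> x0; rewrite exprn_ge0.
  by field.
Qed.

End gauss_moments.

(** * Moments of the normal law *)

Section density.
Context d (T : measurableType d) (R : realType).

(** Radon-Nikodym derivatives being unique almost everywhere, a given density
    can replace the abstract one in the change of variables. *)
Lemma ge0_integral_density (nu : {finite_measure set T -> \bar R})
    (mu : {sigma_finite_measure set T -> \bar R}) (f : T -> R) (h : T -> \bar R) :
  mu.-integrable setT (EFin \o f) -> (forall x, 0 <= h x)%E ->
  measurable_fun setT h ->
  (forall A, measurable A -> nu A = \int[mu]_(x in A) (f x)%:E)%E ->
  (\int[nu]_x h x = \int[mu]_x (h x * (f x)%:E))%E.
Proof.
move=> intf h0 mh nuE.
have numu : nu `<< mu.
  apply/null_content_dominatesP => A mA muA0; rewrite nuE//.
  apply: null_set_integral => //.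
  by apply: measurable_funTS; exact: measurable_int intf.
rewrite -(Radon_Nikodym_SigmaFinite.change_of_variables numu)//.
have mRN := measurable_int _ (Radon_Nikodym_SigmaFinite.f_integrable numu).
have mf := measurable_int _ intf.
apply: ae_eq_integral => //; [exact: emeasurable_funM..|].
apply: ae_eqe_mul2l; apply: integral_ae_eq => //.
  exact: Radon_Nikodym_SigmaFinite.f_integrable.
by move=> A _ mA; rewrite -nuE// -(Radon_Nikodym_SigmaFinite.f_integral numu).
Qed.

End density.

(** The variance 1/2 is the one for which the normal density is
    exp (- x^2) / sqrt pi; other variances are reduced to it by scaling. *)
Section normal_half.
Context d (T : measurableType d) (R : realType) (P : probability T R).
Variable X : {RV P >-> R}.
Hypothesis XN : forall A, measurable A -> P (X @^-1` A) = normal_law 0 (1 / 2) A.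

Lemma ge0_integral_normal_half (h : R -> R) : (forall x, 0 <= h x) ->
  measurable_fun setT h ->
  (\int[P]_w (h (X w))%:E =
   (Num.sqrt pi)^-1%:E * \int[lebesgue_measure]_x (h x * gauss_fun x)%:E)%E.
Proof.
move=> h0 mh.
have mh' : measurable_fun setT (EFin \o h) by exact/measurable_EFinP.
(* the law of X on the copy of R that carries the Lebesgue measure *)
have mX : measurable_fun [set: T] (X : T -> measurableTypeR R) := measurable_funPT X.
pose X' : {mfun T >-> measurableTypeR R} :=
  HB.pack (X : T -> measurableTypeR R) (isMeasurableFun.Build _ _ _ _ _ mX).
transitivity (\int[distribution P X']_x (h x)%:E)%E.
  by rewrite (@ge0_integral_distribution _ _ _ _ _ P X' (EFin \o h)).
have half : (1 / 2 : R) != 0 by rewrite gt_eqF//; lra.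
have half2 : Num.sqrt (1 / 2 : R) ^+ 2 = 1 / 2 by rewrite sqr_sqrtr//; lra.
have pdfE (x : R) : normal_pdf 0 (Num.sqrt (1 / 2)) x = (Num.sqrt pi)^-1 * gauss_fun x.
  rewrite normal_pdfE; last by rewrite gt_eqF// sqrtr_gt0; lra.
  rewrite /normal_peak /normal_fun /gauss_fun half2 subr0.
  have -> : 1 / 2 * pi *+ 2 = pi :> R by rewrite -mulr_natr; field.
  have -> : (1 / 2 : R) *+ 2 = 1 by rewrite -mulr_natr; field.
  by rewrite divr1.
transitivity (\int[normal_prob 0 (Num.sqrt (1 / 2))]_x (h x)%:E)%E.
  apply: (@eq_measure_integral _ (measurableTypeR R) R setT
    (normal_prob 0 (Num.sqrt (1 / 2))) (distribution P X') (EFin \o h)) => A mA _.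
  by have := XN mA; rewrite /normal_law (negbTE half).
rewrite (@ge0_integral_density _ _ _ (normal_prob 0 (Num.sqrt (1 / 2))) lebesgue_measure
    (normal_pdf 0 (Num.sqrt (1 / 2))) (EFin \o h))//.
- rewrite -ge0_integralZl//.
  + apply: eq_integral => x _; rewrite -!EFinM pdfE; congr EFin.
    by rewrite mulrCA.
  + apply/measurable_EFinP; apply: measurable_funM => //.
    exact: measurable_gauss_fun.
  + by move=> x _; rewrite lee_fin mulr_ge0 ?gauss_fun_ge0.
- exact: integrable_normal_pdf.
Qed.

Let sqrt_pi_gt0 : 0 < Num.sqrt (pi : R).
Proof. by rewrite sqrtr_gt0 pi_gt0. Qed.

Lemma normal_half_moment2 : (\int[P]_w (X w ^+ 2)%:E = (1 / 2)%:E)%E.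
Proof.
rewrite (@ge0_integral_normal_half (fun x => x ^+ 2))//.
  by rewrite gauss_moment2 -EFinM; congr EFin; field; rewrite gt_eqF.
by move=> x; rewrite sqr_ge0.
Qed.

Lemma normal_half_moment4 : (\int[P]_w (X w ^+ 4)%:E = (3 / 4)%:E)%E.
Proof.
rewrite (@ge0_integral_normal_half (fun x => x ^+ 4))//.
- by rewrite gauss_moment4 -EFinM; congr EFin; field; rewrite gt_eqF.
- by move=> x; rewrite exprn_even_ge0.
Qed.

Lemma normal_half_abs_moment3 :
  (\int[P]_w (`|X w| ^+ 3)%:E = (Num.sqrt pi)^-1%:E)%E.
Proof.
rewrite (@ge0_integral_normal_half (fun x => `|x| ^+ 3)).
- by rewrite gauss_abs_moment3 mule1.
- by move=> x; rewrite exprn_ge0.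
- by apply: measurable_funX; exact: normr_measurable.
Qed.

End normal_half.

(** * Moments of real random variables *)

Section moments.
Context d (T : measurableType d) (R : realType) (P : probability T R).
Implicit Types (X q : T -> R) (f : R -> R).

Lemma integrable_of_le X q : measurable_fun setT X -> (forall w, `|X w| <= q w) ->
  P.-integrable setT (EFin \o q) -> P.-integrable setT (EFin \o X).
Proof.
move=> mX Xq iq; apply: le_integrable iq => //; first exact/measurable_EFinP.
move=> w _; rewrite /= lee_fin (le_trans (Xq w))//; exact: ler_norm.
Qed.

Lemma integrable_of_ge0 X b : measurable_fun setT X -> (forall w, 0 <= X w) ->
  (\int[P]_w (X w)%:E <= b%:E)%E -> P.-integrable setT (EFin \o X).
Proof.
move=> mX X0 Xb; apply/integrableP; split; first exact/measurable_EFinP.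
rewrite (eq_integral (fun w => (X w)%:E)); last first.
  by move=> w _; rewrite /= ger0_norm.
by rewrite (le_lt_trans Xb)// ltry.
Qed.

Lemma integrable_cst (a : R) : P.-integrable setT (EFin \o (fun=> a) : T -> \bar R).
Proof. exact: finite_measure_integrable_cst. Qed.

Lemma integrableRD X q : P.-integrable setT (EFin \o X) ->
  P.-integrable setT (EFin \o q) -> P.-integrable setT (EFin \o (fun w => X w + q w)).
Proof. by move=> iX iq; exact: (integrableD measurableT iX iq). Qed.

Lemma integrableRZ (a : R) X : P.-integrable setT (EFin \o X) ->
  P.-integrable setT (EFin \o (fun w => a * X w)).
Proof. by move=> iX; exact: (integrableZl measurableT a iX). Qed.

Lemma Rintegral_prob_cst (a : R) : \int[P]_w a = a.
Proof. by rewrite Rintegral_cst//= probability_setT/= mulr1. Qed.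

Lemma EFin_Rintegral X : P.-integrable setT (EFin \o X) ->
  (\int[P]_w (X w)%:E = (\int[P]_w X w)%:E)%E.
Proof. by move=> iX; rewrite fineK//; exact: integrable_fin_num. Qed.

Lemma integrable_pow4 X b k : measurable_fun setT X -> (k <= 4)%N ->
  (\int[P]_w (X w ^+ 4)%:E <= b%:E)%E ->
  P.-integrable setT (EFin \o (fun w => X w ^+ k)).
Proof.
move=> mX k4 Xb.
have iX4 : P.-integrable setT (EFin \o (fun w => X w ^+ 4)).
  apply: (integrable_of_ge0 _ _ Xb); first exact: measurable_funX.
  by move=> w; rewrite exprn_even_ge0.
apply: (@integrable_of_le _ (fun w => 1 + X w ^+ 4)).
- exact: measurable_funX.
- move=> w; rewrite normrX.
  have -> : X w ^+ 4 = `|X w| ^+ 4 by rewrite -normrX ger0_norm// exprn_even_ge0.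
  have x0 := normr_ge0 (X w).
  have [x1|x1] := leP `|X w| 1.
    by rewrite (le_trans (exprn_ile1 _ x0 x1))// lerDl exprn_ge0.
  by rewrite (le_trans (ler_weXn2l (ltW x1) k4))// lerDr.
- exact: integrableRD (integrable_cst 1) iX4.
Qed.

(** Log-convexity of moments, E q^(3/2) <= sqrt (E q * E q^2), obtained by
    integrating q^(3/2) <= (l q + q^2 / l) / 2 with the optimal constant l. *)
Lemma expect_three_halves_le q (V k : R) : measurable_fun setT q ->
  (forall w, 0 <= q w) -> 0 <= V -> 0 < k ->
  (\int[P]_w (q w)%:E <= V%:E)%E ->
  (\int[P]_w (q w ^+ 2)%:E <= (k * V ^+ 2)%:E)%E ->
  (\int[P]_w (q w * Num.sqrt (q w))%:E <= (Num.sqrt k * (V * Num.sqrt V))%:E)%E.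
Proof.
move=> mq q0 V0 k0 q1 q2.
have amgm (l : R) : 0 < l -> (\int[P]_w (q w * Num.sqrt (q w))%:E
    <= (1 / 2 * (l * V) + 1 / (2 * l) * (k * V ^+ 2))%:E)%E.
  move=> l0; apply: (@le_trans _ _ (\int[P]_w
      ((l / 2)%:E * (q w)%:E + (1 / (2 * l))%:E * (q w ^+ 2)%:E)))%E.
    apply: ge0_le_integral => //.
    - by move=> w _; rewrite lee_fin mulr_ge0// sqrtr_ge0.
    - apply/measurable_EFinP; apply: measurable_funM => //.
      by apply: measurableT_comp mq; apply: continuous_measurable_fun;
         exact: sqrt_continuous.
    - apply: emeasurable_funD; apply: measurable_funeM; apply/measurable_EFinP => //.
      exact: measurable_funX.
    - move=> w _; rewrite -!EFinM -EFinD lee_fin.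
      set r := Num.sqrt (q w).
      have -> : q w = r ^+ 2 by rewrite sqr_sqrtr.
      have r0 : 0 <= r := sqrtr_ge0 _.
      rewrite -subr_ge0 (_ : _ - _ = r ^+ 2 * (r - l) ^+ 2 / (2 * l)).
        by apply: divr_ge0; [rewrite mulr_ge0// sqr_ge0|lra].
      by field; lra.
  have c1 : 0 <= l / 2 by lra.
  have c2 : 0 <= 1 / (2 * l) by apply: divr_ge0 => //; lra.
  rewrite ge0_integralD//; last 4 first.
  - by move=> w _; rewrite -EFinM lee_fin mulr_ge0.
  - by apply: measurable_funeM; apply/measurable_EFinP.
  - by move=> w _; rewrite -EFinM lee_fin mulr_ge0// sqr_ge0.
  - by apply: measurable_funeM; apply/measurable_EFinP; exact: measurable_funX.
  rewrite !ge0_integralZl//; last 4 first.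
  - by apply/measurable_EFinP; exact: measurable_funX.
  - by move=> w _; rewrite lee_fin sqr_ge0.
  - exact/measurable_EFinP.
  - by move=> w _; rewrite lee_fin.
  rewrite EFinD; apply: leeD.
    rewrite (_ : 1 / 2 * (l * V) = l / 2 * V); last by field.
    by rewrite [leRHS]EFinM lee_wpmul2l// lee_fin.
  by rewrite [leRHS]EFinM lee_wpmul2l// lee_fin.
(* for V = 0 the optimal l degenerates, but any l gives the bound 0 *)
have [V1|V1] := eqVneq V 0.
  by have := amgm 1 ltr01; rewrite V1 expr0n/= !(mulr0, mul0r) addr0.
have V2 : 0 < V by rewrite lt0r V1.
have l0 : 0 < Num.sqrt k * Num.sqrt V by rewrite mulr_gt0 ?sqrtr_gt0.
apply: (le_trans (amgm _ l0)); rewrite lee_fin.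
have Vk : k = Num.sqrt k ^+ 2 by rewrite sqr_sqrtr ?ltW.
have VV : V = Num.sqrt V ^+ 2 by rewrite sqr_sqrtr.
have := sqrtr_gt0 k; have := sqrtr_gt0 V; rewrite k0 V2.
set a := Num.sqrt k in Vk *; set b := Num.sqrt V in VV * => b0 a0.
rewrite Vk VV le_eqVlt; apply/orP; left; apply/eqP; field.
by rewrite !gt_eqF.
Qed.

End moments.

Section scalar_moments.
Context d (T : measurableType d) (R : realType) (P : probability T R).
Implicit Types (X Y : T -> R) (f : R -> R).

(** A centred variable of variance v whose kurtosis is at most k; the fourth
    moment is bounded in the extended reals, so that the bound also carries the
    integrability of all powers up to 4. *)
Definition centered4 (k v : R) X : Prop :=
  [/\ measurable_fun setT X, (\int[P]_w (X w ^+ 4)%:E <= (k * v ^+ 2)%:E)%E,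
      \int[P]_w X w = 0 & \int[P]_w X w ^+ 2 = v].

Lemma integrable_centered4 k v X j : centered4 k v X -> (j <= 4)%N ->
  P.-integrable setT (EFin \o (fun w => X w ^+ j)).
Proof. by case=> mX X4 _ _ j4; apply: (integrable_pow4 mX j4 X4). Qed.

Lemma integrable_centered4_1 k v X : centered4 k v X ->
  P.-integrable setT (EFin \o X).
Proof.
move=> cX; have := integrable_centered4 cX (isT : (1 <= 4)%N).
by apply: eq_integrable => // w _; rewrite /= expr1.
Qed.

Lemma centered4_ge0 k v X : centered4 k v X -> 0 <= v.
Proof. by case=> _ _ _ <-; apply: Rintegral_ge0 => w _; rewrite sqr_ge0. Qed.

(** Up to an error m / 6 the mean of f (a + X) depends on X only through its
    variance. The constant K makes the integrand nonnegative, as Tonelli's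
    theorem will require. *)
Lemma expect_taylor3 k v X f (a : R) (m K : R) : centered4 k v X ->
  (\int[P]_w (`|X w| ^+ 3)%:E <= m%:E)%E ->
  test_function3 f -> (forall x, `|f x| <= K) ->
  [/\ P.-integrable setT (EFin \o (fun w => f (a + X w) + K)),
      \int[P]_w (f (a + X w) + K)
        <= f a + K + derive1n 2 f a * (v / 2) + m / 6 &
      f a + K + derive1n 2 f a * (v / 2) - m / 6
        <= \int[P]_w (f (a + X w) + K)].
Proof.
move=> cX X3m [_ df cf fb] fK; have [mX _ X1 X2] := cX.
have iX := integrable_centered4_1 cX.
have iX2 := integrable_centered4 cX (isT : (2 <= 4)%N).
have mX3 : measurable_fun setT (fun w => `|X w| ^+ 3).
  by apply: measurable_funX; exact: measurableT_comp.
have iX3 : P.-integrable setT (EFin \o (fun w => `|X w| ^+ 3)).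
  by apply: (integrable_of_ge0 mX3 _ X3m) => w; rewrite exprn_ge0.
have X3 : \int[P]_w `|X w| ^+ 3 <= m.
  by rewrite -lee_fin -EFin_Rintegral.
have mf : measurable_fun setT f.
  by apply: continuous_measurable_fun; exact: (cf 0%N).
have if_ : P.-integrable setT (EFin \o (fun w => f (a + X w) + K)).
  apply: integrableRD; last exact: integrable_cst.
  apply: (@integrable_of_le _ _ _ _ _ (fun=> K)) => [|w|]; last exact: integrable_cst.
    by apply: (measurableT_comp mf); exact: measurable_funD.
  exact: fK.
pose q (e : R) (w : T) := f a + K + derive1n 1 f a * X w + derive1n 2 f a / 2 * X w ^+ 2
  + e * `|X w| ^+ 3.
have iq0 : P.-integrable setT (EFin \o (fun w => f a + K + derive1n 1 f a * X w)).
  by apply: integrableRD (integrable_cst _ _) (integrableRZ _ iX).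
have iq1 : P.-integrable setT (EFin \o (fun w => f a + K + derive1n 1 f a * X w
    + derive1n 2 f a / 2 * X w ^+ 2)).
  by apply: integrableRD iq0 (integrableRZ _ iX2).
have iq e : P.-integrable setT (EFin \o q e).
  by apply: integrableRD iq1 (integrableRZ _ iX3).
have Eq e : \int[P]_w q e w = f a + K + derive1n 2 f a * (v / 2) + e * \int[P]_w `|X w| ^+ 3.
  rewrite RintegralD//; last exact: integrableRZ.
  rewrite RintegralZl//; congr (_ + _).
  rewrite RintegralD//; last exact: integrableRZ.
  rewrite RintegralZl// X2 RintegralD//; [|exact: integrable_cst|exact: integrableRZ].
  by rewrite RintegralZl// X1 Rintegral_prob_cst; field.
have bnd w : q (- (1 / 6)) w <= f (a + X w) + K <= q (1 / 6) w.
  have := @taylor3 R f a (X w) df (fb 3 isT).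
  by rewrite ler_norml /q => /andP[h1 h2]; apply/andP; split; lra.
split => //.
- apply: (@le_trans _ _ (\int[P]_w q (1 / 6) w)).
    by apply: le_Rintegral => // w _; have /andP[] := bnd w.
  by rewrite Eq; lra.
- apply: (@le_trans _ _ (\int[P]_w q (- (1 / 6)) w)).
    by rewrite Eq; lra.
  by apply: le_Rintegral => // w _; have /andP[] := bnd w.
Qed.

End scalar_moments.

(** * Independence *)

Section independence.
Context d (T : measurableType d) (R : realType) (P : probability T R).

Definition indep d1 d2 (V1 : measurableType d1) (V2 : measurableType d2)
    (X : T -> V1) (Y : T -> V2) : Prop :=
  forall A B, measurable A -> measurable B ->
    P (X @^-1` A `&` Y @^-1` B) = (P (X @^-1` A) * P (Y @^-1` B))%E.

(** The joint law of independent X and Y is the product of their laws, so X can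
    be integrated out with Y held fixed. *)
Lemma indep_tonelli d1 d2 (V1 : measurableType d1) (V2 : measurableType d2)
    (X : T -> V1) (Y : T -> V2) (h : V1 * V2 -> \bar R) :
  measurable_fun setT X -> measurable_fun setT Y -> indep X Y ->
  measurable_fun setT h -> (forall z, 0 <= h z)%E ->
  (\int[P]_w h (X w, Y w) = \int[P]_w \int[P]_w' h (X w', Y w))%E.
Proof.
move=> mX mY XY mh h0.
pose X' : {mfun T >-> V1} := HB.pack X (isMeasurableFun.Build _ _ _ _ _ mX).
pose Y' : {mfun T >-> V2} := HB.pack Y (isMeasurableFun.Build _ _ _ _ _ mY).
have mZ : measurable_fun setT (fun w => (X w, Y w)) by exact: measurable_fun_pair.
pose Z : {mfun T >-> (V1 * V2)%type} := HB.pack (fun w => (X w, Y w))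
  (isMeasurableFun.Build _ _ _ _ _ mZ).
rewrite -(@ge0_integral_distribution _ _ _ _ _ P Z h)//.
transitivity (\int[distribution P X' \x distribution P Y']_z h z)%E.
  apply: eq_measure_integral => A mA _; apply/esym.
  by apply: product_measure_unique => // B C mB mC; rewrite -XY.
rewrite fubini_tonelli2// /fubini_G.
rewrite ge0_integral_distribution//; last 2 first.
- exact: measurable_fun_fubini_tonelli_G.
- by move=> y; apply: integral_ge0.
apply: eq_integral => w _ /=.
rewrite ge0_integral_distribution//.
by apply: (measurableT_comp mh); exact: measurable_fun_pair.
Qed.

Section mutual.
Context d' (V : measurableType d') (I : finType) (Z : I -> {RV P >-> V}).

(** The cylinder events of the variables other than Z i: a pi-system generating
    the sigma-algebra of these variables. *)
Definition cylinder_except (i : I) : set_system T :=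
  [set B | exists (J : {set I}) (A : I -> set V), [/\ i \notin J,
     forall j, measurable (A j) & B = \bigcap_(j in [set j | j \in J]) Z j @^-1` A j]].

Lemma cylinder_except_setI i : setI_closed (cylinder_except i).
Proof.
move=> _ _ [J1 [A1 [iJ1 mA1 ->]]] [J2 [A2 [iJ2 mA2 ->]]].
exists (J1 :|: J2)%SET, (fun j => (if j \in J1 then A1 j else setT) `&`
  (if j \in J2 then A2 j else setT)); split.
- by rewrite inE negb_or iJ1.
- by move=> j; apply: measurableI; case: ifP.
- apply/seteqP; split => w.
    move=> [h1 h2] j /=; rewrite inE => jJ; split.
      by case: ifPn => // j1; exact: h1.
    by case: ifPn => // j2; exact: h2.
  move=> h; split => j /= jJ.
    by have [] := h j; rewrite /= ?inE jJ.
  by have [] := h j; rewrite /= ?inE jJ// orbT.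
Qed.

Lemma measurable_preimage (j : I) A : measurable A -> measurable (Z j @^-1` A).
Proof. by move=> mA; rewrite -[X in measurable X]setTI; exact: measurable_funPT. Qed.

Lemma measurable_cylinder_except i : cylinder_except i `<=` measurable.
Proof.
move=> _ [J [A [_ mA ->]]]; apply: fin_bigcap_measurable => // j _.
exact: measurable_preimage.
Qed.

Lemma measurable_g_cylinder_except i : <<s cylinder_except i >> `<=` measurable.
Proof.
apply: smallest_sub; last exact: measurable_cylinder_except.
by split; [exact: measurable0|move=> A mA; rewrite setTD; exact: measurableC
          |move=> A mA; exact: bigcupT_measurable].
Qed.

Lemma measurable_fun_except i j : j != i ->
  measurable_fun setT (Z j : g_sigma_algebraType (cylinder_except i) -> V).
Proof.
move=> ji _ A mA; rewrite setTI; apply: sub_sigma_algebra.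
exists [set j]%SET, (fun=> A); split => //; first by rewrite inE eq_sym.
apply/seteqP; split => w /=; first by move=> h k /=; rewrite inE => /eqP ->.
by apply; rewrite /= inE.
Qed.

(** For a fixed event A of Z i, the finite measures B |-> P (A & B) and
    B |-> P A * P B agree on cylinder events, hence on the sigma-algebra they
    generate. *)
Lemma mutually_independent_indep i d2 (V2 : measurableType d2) (Y : T -> V2) :
  mutually_independent P Z ->
  measurable_fun setT (Y : g_sigma_algebraType (cylinder_except i) -> V2) ->
  measurable_fun setT Y /\ indep (Z i) Y.
Proof.
move=> ZI mY.
have mYP B : measurable B -> <<s cylinder_except i >> (Y @^-1` B).
  by move=> mB; have := mY measurableT B mB; rewrite setTI.
split=> [_ B mB|A B mA mB].
  by rewrite setTI; apply: measurable_g_cylinder_except; exact: mYP.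
have mZA := measurable_preimage i mA.
pose m1 : set T -> \bar R := mrestr P mZA.
have PZA : (0 <= P (Z i @^-1` A))%E by [].
pose m2 : set T -> \bar R := mscale (NngNum (fine_ge0 PZA)) P.
have m2E C : m2 C = (P (Z i @^-1` A) * P C)%E.
  by rewrite /m2 /mscale/= fineK// fin_num_measure.
rewrite setIC -m2E.
have -> : P (Y @^-1` B `&` Z i @^-1` A) = m1 (Y @^-1` B) by [].
apply: (@g_sigma_algebra_measure_unique _ _ _ (cylinder_except i) _ (fun=> setT)
  _ _ (mrestr P mZA) (mscale (NngNum (fine_ge0 PZA)) P)).
- exact: measurable_cylinder_except.
- move=> _; exists finset.set0, (fun=> setT); split => //; first by rewrite inE.
  by apply/seteqP; split => // w _ j /=; rewrite inE.
- by apply/seteqP; split => // w _; exists 0%N.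
- exact: cylinder_except_setI.
- move=> _ [J [C [iJ mC ->]]].
  transitivity (m2 (\bigcap_(j in [set j | j \in J]) Z j @^-1` C j)) => //.
  rewrite m2E (ZI _ _ mC).
  pose C' j := if j == i then A else C j.
  have mC' j : measurable (C' j) by rewrite /C'; case: eqP.
  have := ZI (i |: J)%SET C' mC'; rewrite big_setU1//= {2}/C' eqxx.
  rewrite (eq_bigr (fun j => P (Z j @^-1` C j))); last first.
    by move=> j jJ; rewrite /C'; case: eqP => // ji; rewrite ji (negbTE iJ) in jJ.
  move=> <-; rewrite /mrestr; congr (P _); apply/seteqP; split => w.
    move=> [h1 h2] j /=; rewrite !inE /C' => /predU1P[->|jJ].
      by rewrite eqxx.
    by case: eqP => [->|_]//; exact: h1.
  move=> h; split=> [j /= jJ|/=].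
    have := h j; rewrite /= !inE jJ orbT /C' => /(_ isT).
    by case: eqP => // ji; rewrite -ji jJ in iJ.
  by have := h i; rewrite /= !inE eqxx /C' eqxx => /(_ isT).
- by move=> _; rewrite /mrestr ltey_eq fin_num_measure//; apply: measurableI.
- exact: mYP.
Qed.
End mutual.
End independence.

(** * Fourth moments of sums of independent variables *)

Section sums.
Context d (T : measurableType d) (R : realType) (P : probability T R).

Lemma indep_comp d1 d2 d3 (V1 : measurableType d1) (V2 : measurableType d2)
    (V3 : measurableType d3) (X : T -> V1) (Y : T -> V2) (f : V1 -> V3) :
  measurable_fun setT f -> indep P X Y -> indep P (f \o X) Y.
Proof.
move=> mf XY A B mA mB; rewrite comp_preimage; apply: XY => //.
by rewrite -[X in measurable X]setTI; exact: mf.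
Qed.

Lemma centered4_0 k : centered4 P k 0 (fun=> 0).
Proof.
split => //.
- under eq_integral do rewrite expr0n/=.
  by rewrite integral0 expr0n/= mulr0.
- exact: Rintegral_prob_cst.
- by under eq_Rintegral do rewrite expr0n/=; exact: Rintegral_prob_cst.
Qed.

Lemma centered4_scale k v a (X : T -> R) : centered4 P k v X ->
  centered4 P k (a ^+ 2 * v) (fun w => a * X w).
Proof.
move=> cX; have [mX X4 X1 X2] := cX; split.
- exact: measurable_funM.
- under eq_integral do rewrite exprMn EFinM.
  rewrite ge0_integralZl//; last 3 first.
  + by apply/measurable_EFinP; exact: measurable_funX.
  + by move=> w _; rewrite lee_fin exprn_even_ge0.
  + by rewrite lee_fin exprn_even_ge0.
  rewrite (_ : k * _ = a ^+ 4 * (k * v ^+ 2)); last by ring.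
  by rewrite [leRHS]EFinM lee_wpmul2l// lee_fin exprn_even_ge0.
- by rewrite RintegralZl ?X1 ?mulr0//; exact: integrable_centered4_1 cX.
- under eq_Rintegral do rewrite exprMn.
  by rewrite RintegralZl ?X2//; exact: (integrable_centered4 cX).
Qed.

(** For independent centred summands the cross terms of odd degree vanish, and
    the mixed term 6 u v is absorbed by 2 k u v as soon as 3 <= k. *)
Lemma centered4_add k u v (X Y : T -> R) : 3 <= k -> indep P X Y ->
  centered4 P k u X -> centered4 P k v Y -> centered4 P k (u + v) (fun w => X w + Y w).
Proof.
move=> k3 XY cX cY; have [mX X4 X1 X2] := cX; have [mY Y4 Y1 Y2] := cY.
have u0 := centered4_ge0 cX; have v0 := centered4_ge0 cY.
have iX := integrable_centered4_1 cX; have iY := integrable_centered4_1 cY.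
have iXj j := @integrable_centered4 _ _ _ _ _ _ _ j cX.
have iYj j := @integrable_centered4 _ _ _ _ _ _ _ j cY.
have mXY : measurable_fun setT (fun w => X w + Y w) by exact: measurable_funD.
have mh j : measurable_fun setT (fun z : R * R => ((z.1 + z.2) ^+ j)%:E).
  by apply/measurable_EFinP; apply: measurable_funX; exact: measurable_funD.
split => //.
- pose x3 := \int[P]_w X w ^+ 3; pose x4 := \int[P]_w X w ^+ 4.
  rewrite (indep_tonelli mX mY XY (mh 4%N)) => [|z]; last by rewrite lee_fin exprn_even_ge0.
  under eq_integral => w _ do rewrite /=.
  have inner w : (\int[P]_w' ((X w' + Y w) ^+ 4)%:E =
      (x4 + 4 * x3 * Y w + 6 * u * Y w ^+ 2 + Y w ^+ 4)%:E)%E.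
    have iA : P.-integrable setT (EFin \o (fun w' => X w' ^+ 4 + 4 * Y w * X w' ^+ 3)).
      by apply: integrableRD; [exact: iXj|apply: integrableRZ; exact: iXj].
    have iB : P.-integrable setT (EFin \o (fun w' => X w' ^+ 4 + 4 * Y w * X w' ^+ 3
        + 6 * Y w ^+ 2 * X w' ^+ 2)).
      by apply: integrableRD => //; apply: integrableRZ; exact: iXj.
    have iC : P.-integrable setT (EFin \o (fun w' => X w' ^+ 4 + 4 * Y w * X w' ^+ 3
        + 6 * Y w ^+ 2 * X w' ^+ 2 + 4 * Y w ^+ 3 * X w')).
      by apply: integrableRD => //; apply: integrableRZ.
    have iD : P.-integrable setT (EFin \o (fun w' => X w' ^+ 4 + 4 * Y w * X w' ^+ 3
        + 6 * Y w ^+ 2 * X w' ^+ 2 + 4 * Y w ^+ 3 * X w' + Y w ^+ 4)).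
      by apply: integrableRD => //; exact: integrable_cst.
    under eq_integral => w' _.
      rewrite (_ : (X w' + Y w) ^+ 4 = X w' ^+ 4 + 4 * Y w * X w' ^+ 3
        + 6 * Y w ^+ 2 * X w' ^+ 2 + 4 * Y w ^+ 3 * X w' + Y w ^+ 4); last by ring.
      over.
    rewrite EFin_Rintegral//; congr EFin.
    rewrite RintegralD//; last exact: integrable_cst.
    rewrite RintegralD//; last exact: integrableRZ.
    rewrite RintegralD//; last by apply: integrableRZ; exact: iXj.
    rewrite RintegralD//; [|exact: iXj|by apply: integrableRZ; exact: iXj].
    rewrite (RintegralZl _ measurableT iX) (RintegralZl _ measurableT (iXj 2%N isT)).
    rewrite (RintegralZl _ measurableT (iXj 3%N isT)).
    by rewrite Rintegral_prob_cst X1 X2 -/x3 -/x4; ring.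
  under eq_integral => w _ do rewrite inner.
  have iA : P.-integrable setT (EFin \o (fun w => x4 + 4 * x3 * Y w)).
    by apply: integrableRD; [exact: integrable_cst|exact: integrableRZ].
  have iB : P.-integrable setT (EFin \o (fun w => x4 + 4 * x3 * Y w + 6 * u * Y w ^+ 2)).
    by apply: integrableRD => //; apply: integrableRZ; exact: iYj.
  rewrite EFin_Rintegral; last by apply: integrableRD => //; exact: iYj.
  rewrite RintegralD//; last exact: iYj.
  rewrite RintegralD//; last by apply: integrableRZ; exact: iYj.
  rewrite RintegralD//; [|exact: integrable_cst|exact: integrableRZ].
  rewrite (RintegralZl _ measurableT iY) (RintegralZl _ measurableT (iYj 2%N isT)).
  rewrite Rintegral_prob_cst Y1 Y2 lee_fin.
  have : x4 <= k * u ^+ 2 by rewrite -lee_fin -EFin_Rintegral//; exact: iXj.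
  have : \int[P]_w Y w ^+ 4 <= k * v ^+ 2 by rewrite -lee_fin -EFin_Rintegral//; exact: iYj.
  have : 0 <= (k - 3) * (u * v) by rewrite !mulr_ge0 ?subr_ge0.
  by lra.
- by rewrite RintegralD// X1 Y1 addr0.
- rewrite /Rintegral (indep_tonelli mX mY XY (mh 2%N)) => [|z]; last by rewrite lee_fin sqr_ge0.
  have inner w : (\int[P]_w' ((X w' + Y w) ^+ 2)%:E = (u + Y w ^+ 2)%:E)%E.
    have iA : P.-integrable setT (EFin \o (fun w' => X w' ^+ 2 + 2 * Y w * X w')).
      by apply: integrableRD; [exact: iXj|exact: integrableRZ].
    under eq_integral => w' _.
      rewrite (_ : (X w' + Y w) ^+ 2 = X w' ^+ 2 + 2 * Y w * X w' + Y w ^+ 2); last by ring.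
      over.
    rewrite EFin_Rintegral; last by apply: integrableRD => //; exact: integrable_cst.
    congr EFin; rewrite RintegralD//; last exact: integrable_cst.
    rewrite RintegralD//; [|exact: iXj|exact: integrableRZ].
    by rewrite RintegralZl// X1 X2 Rintegral_prob_cst mulr0 addr0.
  under eq_integral => w _ do rewrite inner.
  rewrite -/(Rintegral P setT (fun w => u + Y w ^+ 2)).
  rewrite RintegralD//; [|exact: integrable_cst|exact: iYj].
  by rewrite Rintegral_prob_cst Y2.
Qed.

Section family.
Context d' (V : measurableType d') (I : finType) (Z : I -> {RV P >-> V}).
Hypothesis ZI : mutually_independent P Z.

Lemma centered4_sum k (f : I -> V -> R) (v : I -> R) (s : seq I) :
  3 <= k -> uniq s -> (forall i, measurable_fun setT (f i)) ->
  (forall i, centered4 P k (v i) (fun w => f i (Z i w))) ->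
  centered4 P k (\sum_(i <- s) v i) (fun w => \sum_(i <- s) f i (Z i w)).
Proof.
move=> k3 + mf cf; elim: s => [_|i s IH /= /andP[is_ us]].
  rewrite big_nil; under eq_fun do rewrite big_nil.
  exact: centered4_0.
rewrite big_cons (_ : (fun w => _) = fun w => f i (Z i w) + \sum_(j <- s) f j (Z j w));
  last by apply/funext => w; rewrite big_cons.
apply: centered4_add => //; last exact: IH.
apply: (indep_comp (X := Z i) (mf i)).
apply: (proj2 (mutually_independent_indep (i := i) ZI _)).
rewrite [X in measurable_fun _ X](_ : _ = fun w => \sum_(j <- s | j != i) f j (Z j w)).
  under eq_fun do rewrite big_mkcond/=.
  apply: (@measurable_sum _ (g_sigma_algebraType (cylinder_except Z i)) R setT I s
    (fun j (w : g_sigma_algebraType (cylinder_except Z i)) =>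
    if j != i then f j (Z j w) else 0)) => j.
  case: (eqVneq j i) => [_|ji] /=; first exact: measurable_cst.
  by apply: (measurableT_comp (mf j)); exact: measurable_fun_except.
apply/funext => w; rewrite big_seq_cond [RHS]big_seq_cond; apply: eq_bigl => j.
by rewrite andbT; case: (boolP (j \in s)) => //= js; apply/esym; apply: contra is_ => /eqP <-.
Qed.

End family.

End sums.

(** * Quadratic forms and Gram matrices *)

Section quadratic_forms.
Context {R : realType}.

Lemma dotMr m n (B : 'M[R]_(n, m)) (u : 'cV[R]_n) (x : 'cV[R]_m) :
  dot u (B *m x) = dot (B^T *m u) x.
Proof. by rewrite /dot trmx_mul trmxK mulmxA. Qed.

Lemma dotZr m (a : R) (u v : 'cV[R]_m) : dot u (a *: v) = a * dot u v.
Proof. by rewrite /dot -scalemxAr mxE. Qed.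

Lemma dotZl m (a : R) (u v : 'cV[R]_m) : dot (a *: u) v = a * dot u v.
Proof. by rewrite /dot linearZ -scalemxAl mxE. Qed.

Lemma dotC m (u v : 'cV[R]_m) : dot u v = dot v u.
Proof. by rewrite !dotE; apply: eq_bigr => k _; rewrite mulrC. Qed.

Lemma dot_sumr m (I : Type) (s : seq I) (Q : pred I) (u : 'cV[R]_m) (f : I -> 'cV[R]_m) :
  dot u (\sum_(i <- s | Q i) f i) = \sum_(i <- s | Q i) dot u (f i).
Proof. by rewrite /dot mulmx_sumr summxE. Qed.

Definition psd m (S : 'M[R]_m) : Prop :=
  S^T = S /\ forall x, 0 <= dot x (S *m x).

Lemma dot_block m (a : R) (b : 'rV[R]_m) (D : 'M[R]_m) (t : R) (x : 'cV[R]_m) :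
  dot (col_mx t%:M x) (block_mx a%:M b b^T D *m col_mx t%:M x)
  = a * t ^+ 2 + 2 * t * (b *m x) 0 0 + dot x (D *m x).
Proof.
have addE (A B : 'M[R]_1) : (A + B) 0 0 = A 0 0 + B 0 0 by rewrite mxE.
have scaleE c (A : 'M[R]_1) : (c *: A) 0 0 = c * A 0 0 by rewrite mxE.
have oneE (c : R) : (c%:M : 'M[R]_1) 0 0 = c by rewrite mxE eqxx mulr1n.
have bxE : (x^T *m b^T) 0 0 = (b *m x) 0 0 by rewrite -trmx_mul mxE.
rewrite /dot mul_block_col tr_col_mx mul_row_col tr_scalar_mx !mulmxDr.
rewrite !mul_scalar_mx !mul_mx_scalar -scalemxAr !addE !scaleE bxE oneE.
by ring.
Qed.

(** Cholesky factorization, by induction on the size. When the corner entry a is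
    positive the Schur complement D - b^T b / a is again positive semidefinite;
    when it vanishes so does the row b, and D is factored instead. *)
Lemma psd_factor m (S : 'M[R]_m) : psd S -> exists B : 'M[R]_m, S = B^T *m B.
Proof.
elim: m S => [S _|m IH S].
  by exists 0; apply/matrixP => -[].
move=> [symS posS]; pose S' : 'M[R]_(1 + m) := S.
change (exists B : 'M[R]_(1 + m), S' = B^T *m B).
pose a : R := S' 0 0; pose b : 'rV[R]_m := ursubmx S'; pose D : 'M[R]_m := drsubmx S'.
have SE : S' = block_mx a%:M b b^T D.
  rewrite -[LHS]submxK; congr block_mx.
    apply/matrixP => i j; rewrite !ord1 !mxE eqxx mulr1n.
    by congr (S' _ _); apply/val_inj.
  by rewrite /b trmx_ursub; congr dlsubmx; rewrite /S' symS.
have symD : D^T = D by rewrite /D trmx_drsub; congr drsubmx; rewrite /S' symS.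
have form t (x : 'cV[R]_m) : 0 <= a * t ^+ 2 + 2 * t * (b *m x) 0 0 + dot x (D *m x).
  by rewrite -dot_block -SE; exact: posS.
have a0 : 0 <= a.
  by have := form 1 0; rewrite !mulmx0 /dot mulmx0 !mxE mulr0 !addr0 expr1n mulr1.
have [az|an0] := eqVneq a 0.
  have b0 : b = 0.
    (* otherwise t |-> 2 t (b x) + x D x takes negative values for x := b^T *)
    have pos_bb : forall k, 0 <= b 0 k * b 0 k by move=> k; rewrite -expr2 sqr_ge0.
    set bb := (b *m b^T) 0 0; set dd := dot b^T (D *m b^T).
    have bbE : bb = \sum_k b 0 k * b 0 k.
      by rewrite /bb mxE; apply: eq_bigr => k _; rewrite [b^T _ _]mxE.
    have bb0 : bb = 0.
      apply/eqP; rewrite eq_le; apply/andP; split; last by rewrite bbE sumr_ge0.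
      rewrite leNgt; apply/negP => bbp.
      have := form (- (dd + 1) / (2 * bb)) b^T; rewrite az -/bb -/dd.
      rewrite (_ : 0 * _ + _ + dd = - 1); first by rewrite oppr_ge0 ler10.
      by field; rewrite gt_eqF.
    apply/rowP => k; rewrite [RHS]mxE.
    move/eqP: bb0; rewrite bbE psumr_eq0// => /allP/(_ k (mem_index_enum _)).
    by rewrite mulf_eq0 orbb => /eqP.
  have [|B DE] := IH D.
    by split=> // x; have := form 0 x; rewrite expr0n/= !mulr0 mul0r !add0r.
  exists (block_mx 0 0 0 B : 'M[R]_(1 + m)); rewrite SE az b0 DE.
  rewrite tr_block_mx mulmx_block !(trmx0, mul0mx, mulmx0, addr0, add0r).
  by congr block_mx; apply/matrixP => i j; rewrite !mxE mul0rn.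
have ap : 0 < a by rewrite lt0r an0.
have [|B DE] := IH (D - a^-1 *: (b^T *m b)).
  split=> [|x]; first by rewrite linearB linearZ/= symD trmx_mul trmxK.
  have := form (- (b *m x) 0 0 / a) x.
  rewrite mulmxBl -scalemxAl /dot mulmxBr -scalemxAr -!/(dot _ _).
  have -> : x^T *m (b^T *m b *m x) = ((b *m x) 0 0 ^+ 2)%:M.
    rewrite -mulmxA mulmxA -trmx_mul {1 2}[b *m x]mx11_scalar.
    by rewrite tr_scalar_mx -scalar_mxM expr2.
  have subE (A : 'M[R]_1) c e : (A - c *: e%:M) 0 0 = A 0 0 - c * e.
    by rewrite !mxE eqxx mulr1n.
  rewrite subE.
  by congr (0 <= _); rewrite /dot; field.
have sa : Num.sqrt a ^+ 2 = a by rewrite sqr_sqrtr.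
have sa0 : Num.sqrt a != 0 by rewrite sqrtr_eq0 -ltNge.
exists (block_mx (Num.sqrt a)%:M ((Num.sqrt a)^-1 *: b) 0 B : 'M[R]_(1 + m)).
rewrite SE tr_block_mx mulmx_block !(trmx0, mul0mx, mulmx0, addr0, add0r).
rewrite -DE tr_scalar_mx !linearZ/=; congr block_mx.
- by rewrite -scalar_mxM -expr2 sa.
- by rewrite mul_scalar_mx scalerA mulVf// scale1r.
- by rewrite mul_mx_scalar scalerA divff// scale1r.
- by rewrite scalerN -scalemxAl scalerA -invfM -expr2 sa addrCA subrr addr0.
Qed.

Lemma dot_gram m (B : 'M[R]_m) (x : 'cV[R]_m) :
  dot x (B^T *m B *m x) = \sum_i dot (row i B)^T x ^+ 2.
Proof.
rewrite -mulmxA dotMr trmxK dotE; apply: eq_bigr => i _; rewrite -expr2; congr (_ ^+ 2).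
by rewrite dotE mxE; apply: eq_bigr => j _; rewrite !mxE.
Qed.

Lemma trace_gram m (B S : 'M[R]_m) :
  \tr ((B^T *m B) *m S) = \sum_i dot (row i B)^T (S *m (row i B)^T).
Proof.
rewrite -mulmxA mxtrace_mulC -mulmxA /mxtrace; apply: eq_bigr => i _.
rewrite mxE dotE; apply: eq_bigr => k _; rewrite !mxE; congr (_ * _).
by apply: eq_bigr => j _; rewrite !mxE.
Qed.

End quadratic_forms.

(** * Moments of random quadratic forms *)

Section random_quadratic_forms.
Context d (T : measurableType d) (R : realType) (P : probability T R).

(** Minkowski's inequality in L^2, from the pointwise Cauchy-Schwarz bound
    (f + g)^2 <= (u + v) (f^2 / u + g^2 / v). *)
Lemma expect_sqrD_le (k u v : R) (f g : T -> R) : 0 < u -> 0 < v ->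
  measurable_fun setT f -> measurable_fun setT g ->
  (\int[P]_w (f w ^+ 2)%:E <= (k * u ^+ 2)%:E)%E ->
  (\int[P]_w (g w ^+ 2)%:E <= (k * v ^+ 2)%:E)%E ->
  (\int[P]_w ((f w + g w) ^+ 2)%:E <= (k * (u + v) ^+ 2)%:E)%E.
Proof.
move=> u0 v0 mf mg fu gv.
have a0 : 0 <= (u + v) / u by apply: divr_ge0; lra.
have b0 : 0 <= (u + v) / v by apply: divr_ge0; lra.
have mf2 : measurable_fun setT (EFin \o (fun w => f w ^+ 2)).
  by apply/measurable_EFinP; exact: measurable_funX.
have mg2 : measurable_fun setT (EFin \o (fun w => g w ^+ 2)).
  by apply/measurable_EFinP; exact: measurable_funX.
apply: (@le_trans _ _ (\int[P]_w
    (((u + v) / u)%:E * (f w ^+ 2)%:E + ((u + v) / v)%:E * (g w ^+ 2)%:E)))%E.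
  apply: ge0_le_integral => //.
  - by move=> w _; rewrite lee_fin sqr_ge0.
  - by apply/measurable_EFinP; apply: measurable_funX; exact: measurable_funD.
  - by apply: emeasurable_funD; exact: measurable_funeM.
  - move=> w _; rewrite -!EFinM -EFinD lee_fin -subr_ge0.
    rewrite (_ : _ - _ = (v * f w - u * g w) ^+ 2 / (u * v)); last by field; rewrite !gt_eqF.
    by apply: divr_ge0; rewrite ?sqr_ge0// mulr_ge0// ltW.
rewrite ge0_integralD//; last 4 first.
- by move=> w _; rewrite -EFinM lee_fin mulr_ge0// sqr_ge0.
- exact: measurable_funeM.
- by move=> w _; rewrite -EFinM lee_fin mulr_ge0// sqr_ge0.
- exact: measurable_funeM.
rewrite !ge0_integralZl//; last 2 first.
- by move=> w _; rewrite lee_fin sqr_ge0.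
- by move=> w _; rewrite lee_fin sqr_ge0.
rewrite (_ : k * (u + v) ^+ 2 = (u + v) / u * (k * u ^+ 2) + (u + v) / v * (k * v ^+ 2));
  last by field; rewrite !gt_eqF.
by rewrite EFinD; apply: leeD; rewrite [leRHS]EFinM lee_wpmul2l// lee_fin.
Qed.

Lemma expect_sqr_sum_le (I : Type) (s : seq I) (k : R) (v : I -> R) (q : I -> T -> R) :
  0 <= k -> (forall i, measurable_fun setT (q i)) -> (forall i, 0 <= v i) ->
  (forall i, \int[P]_w (q i w ^+ 2)%:E <= (k * v i ^+ 2)%:E)%E ->
  (\int[P]_w ((\sum_(i <- s) q i w) ^+ 2)%:E <= (k * (\sum_(i <- s) v i) ^+ 2)%:E)%E.
Proof.
move=> k0 mq v0 qv.
have vs0 : 0 <= \sum_(i <- s) v i by exact: sumr_ge0.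
(* the bound with v enlarged by e, so that expect_sqrD_le applies *)
have enlarged e : 0 < e ->
    (\int[P]_w ((\sum_(i <- s) q i w) ^+ 2)%:E <= (k * (\sum_(i <- s) v i + e) ^+ 2)%:E)%E.
  move: e; elim: s {vs0} => [|i s IH] e e0.
    under eq_integral do rewrite big_nil expr0n/=.
    by rewrite integral0 lee_fin mulr_ge0// sqr_ge0.
  under eq_integral do rewrite big_cons.
  rewrite big_cons (_ : v i + _ + e = (v i + e / 2) + (\sum_(j <- s) v j + e / 2)); last by field.
  apply: expect_sqrD_le.
  - by have := v0 i; lra.
  - by have : 0 <= \sum_(j <- s) v j by [exact: sumr_ge0]; lra.
  - exact: mq.
  - exact: measurable_sum.
  - rewrite (le_trans (qv i))// lee_fin ler_wpM2l// lerXn2r ?nnegrE ?v0//.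
      by have := v0 i; lra.
    by lra.
  - by apply: IH; lra.
set V := \sum_(i <- s) v i in vs0 enlarged *.
set J := (\int[P]_w _)%E in enlarged *.
have J0 : (0 <= J)%E by apply: integral_ge0 => w _; rewrite lee_fin sqr_ge0.
have Jfin : J \is a fin_num.
  by rewrite ge0_fin_numE// (le_lt_trans (enlarged _ ltr01))// ltry.
rewrite -(fineK Jfin) in enlarged *; move: (fine J) enlarged => j enl.
rewrite lee_fin; apply/ler_addgt0Pl => x x0.
have c0 : 0 < k * (2 * V + 1) + 1 by rewrite ltr_wpDl// mulr_ge0//; lra.
pose e := Num.min 1 (x / (k * (2 * V + 1) + 1)).
have e0 : 0 < e by rewrite lt_min ltr01 divr_gt0.
have e1 : e <= 1 by rewrite ge_min lexx.
have ex : e * (k * (2 * V + 1) + 1) <= x by rewrite -ler_pdivlMr// ge_min lexx orbT.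
have := enl e e0; rewrite lee_fin => /le_trans; apply.
have ke : k * e * e <= k * e by rewrite ler_piMr// mulr_ge0// ltW.
by nra.
Qed.

Context (m : nat).
Variables (S : T -> 'cV[R]_m) (W Om : 'M[R]_m) (k : R).
Hypotheses (k1 : 0 < k) (psdOm : psd Om).
Hypothesis cS : forall b, centered4 P k (dot b (W *m b)) (fun w => dot b (S w)).

(** With Om = B^T B the form q is the sum of the squares of the linear
    functionals of S given by the rows of B. Their fourth moments are controlled
    by their variances, whose sum is V = tr (Om W); Minkowski's inequality then
    gives E q^2 <= k V^2, with the same constant k as for one functional. *)
Lemma expect_quad_form_three_halves :
  let q w := dot (S w) (Om *m S w) in let V := \tr (Om *m W) in
  [/\ 0 <= V, measurable_fun setT q & forall w, 0 <= q w] /\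
  (\int[P]_w (q w * Num.sqrt (q w))%:E <= (Num.sqrt k * (V * Num.sqrt V))%:E)%E.
Proof.
move=> q V; have [B OmE] := psd_factor psdOm.
pose b i := (row i B)^T.
have qE w : q w = \sum_i dot (b i) (S w) ^+ 2 by rewrite /q OmE dot_gram.
have VE : V = \sum_i dot (b i) (W *m b i) by rewrite /V OmE trace_gram.
have v0 i : 0 <= dot (b i) (W *m b i) := centered4_ge0 (cS (b i)).
have mb i : measurable_fun setT (fun w => dot (b i) (S w)) by case: (cS (b i)).
have V0 : 0 <= V by rewrite VE sumr_ge0.
have mq : measurable_fun setT q.
  rewrite (_ : q = fun w => \sum_i dot (b i) (S w) ^+ 2); last exact/funext.
  by apply: measurable_sum => i; exact: measurable_funX.
have q0 w : 0 <= q w by rewrite qE sumr_ge0// => i _; exact: sqr_ge0.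
split=> //; apply: expect_three_halves_le => //.
- under eq_integral do rewrite qE -sumEFin.
  rewrite ge0_integral_sum//; last 2 first.
  + by move=> i; apply/measurable_EFinP; exact: measurable_funX.
  + by move=> i w _; rewrite lee_fin sqr_ge0.
  rewrite VE -sumEFin; apply: lee_sum => i _.
  have [_ _ _ <-] := cS (b i).
  by rewrite EFin_Rintegral//; exact: integrable_centered4 (cS (b i)) _.
- under eq_integral do rewrite qE.
  rewrite VE; apply: expect_sqr_sum_le => //; first exact: ltW.
  + by move=> i; exact: measurable_funX.
  + move=> i; under eq_integral do rewrite -exprM.
    by case: (cS (b i)).
Qed.

End random_quadratic_forms.

(** * Replacement of one vector *)

Section lindeberg_step.
Context d (T : measurableType d) (R : realType) (P : probability T R).

Lemma measurable_inner_integral d1 d2 (V1 : measurableType d1) (V2 : measurableType d2)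
    (X : T -> V1) (Y : T -> V2) (h : V1 * V2 -> \bar R) :
  measurable_fun setT X -> measurable_fun setT Y ->
  measurable_fun setT h -> (forall z, 0 <= h z)%E ->
  measurable_fun setT (fun w => \int[P]_w' h (X w', Y w))%E.
Proof.
move=> mX mY mh h0.
pose X' : {mfun T >-> V1} := HB.pack X (isMeasurableFun.Build _ _ _ _ _ mX).
rewrite (_ : (fun w => _) = fubini_G (distribution P X') h \o Y); last first.
  apply/funext => w; rewrite /fubini_G /= ge0_integral_distribution//.
  by apply: (measurableT_comp mh); exact: measurable_fun_pair.
by apply: measurableT_comp => //; exact: measurable_fun_fubini_tonelli_G.
Qed.

Lemma measurable_dot d0 (T0 : measurableType d0) m (x y : T0 -> 'cV[R]_m) :
  measurable_fun setT x -> measurable_fun setT y ->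
  measurable_fun setT (fun w => dot (x w) (y w)).
Proof.
move=> mx my; under eq_fun do rewrite dotE.
apply: measurable_sum => k; apply: measurable_funM.
  exact: (measurableT_comp (measurable_entry k 0) mx).
exact: (measurableT_comp (measurable_entry k 0) my).
Qed.

Context (m : nat) (I : finType) (a : I -> I -> R).
Hypotheses (a_sym : forall i j, a i j = a j i) (a_diag : forall i, a i i = 0).

Definition qform (z : I -> 'cV[R]_m) : R :=
  1 / 2 * \sum_i \sum_j a i j * dot (z i) (z j).

Definition qform_slope (k : I) (z : I -> 'cV[R]_m) : 'cV[R]_m :=
  \sum_(j | j != k) a k j *: z j.

Definition qform_rest (k : I) (z : I -> 'cV[R]_m) : R :=
  1 / 2 * \sum_(i | i != k) \sum_(j | j != k) a i j * dot (z i) (z j).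

(** A quadratic form without diagonal terms is affine in each of its arguments. *)
Lemma qform_split k z : qform z = qform_rest k z + dot (qform_slope k z) (z k).
Proof.
rewrite /qform /qform_rest (bigD1 k)//= (bigD1 k)//= a_diag mul0r add0r.
have -> : \sum_(i | i != k) \sum_j a i j * dot (z i) (z j) =
   \sum_(i | i != k) a k i * dot (z k) (z i) +
   \sum_(i | i != k) \sum_(j | j != k) a i j * dot (z i) (z j).
  rewrite -big_split/=; apply: eq_bigr => i _.
  by rewrite (bigD1 k)//= (a_sym i k) (dotC (z i)).
have -> : dot (qform_slope k z) (z k) = \sum_(i | i != k) a k i * dot (z k) (z i).
  by rewrite dotC dot_sumr; apply: eq_bigr => i _; rewrite dotZr.
by field.
Qed.

Section measurability.
Context d0 (T0 : measurableType d0) (k : I) (z : I -> T0 -> 'cV[R]_m).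
Hypothesis mz : forall j, j != k -> measurable_fun setT (z j).

Lemma measurable_qform_slope : measurable_fun setT (fun w => qform_slope k (z ^~ w)).
Proof.
apply: measurable_matrixP => i l; rewrite ord1.
rewrite (_ : (fun w => _) = fun w => \sum_j if j != k then a k j * z j w i 0 else 0).
  apply: measurable_sum => j; case: (eqVneq j k) => [_|jk] /=; first exact: measurable_cst.
  apply: measurable_funM => //.
  exact: (measurableT_comp (measurable_entry i 0) (mz jk)).
apply/funext => w; rewrite /qform_slope summxE big_mkcond/=; apply: eq_bigr => j _.
by case: ifP => // _; rewrite mxE.
Qed.

Lemma measurable_qform_rest : measurable_fun setT (fun w => qform_rest k (z ^~ w)).
Proof.
apply: measurable_funM => //.
rewrite (_ : (fun w => _) = fun w => \sum_i \sum_j if (i != k) && (j != k)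
    then a i j * dot (z i w) (z j w) else 0).
  apply: measurable_sum => i; apply: measurable_sum => j.
  case: (eqVneq i k) => [_|ik] /=; first exact: measurable_cst.
  case: (eqVneq j k) => [_|jk] /=; first exact: measurable_cst.
  by apply: measurable_funM => //; apply: measurable_dot; exact: mz.
apply/funext => w; rewrite big_mkcond; apply: eq_bigr => i _.
by case: ifP => //= _; rewrite ?big_mkcond// big1.
Qed.

End measurability.

Context (Om : I -> 'M[R]_m) (M : R).
Hypotheses (psdOm : forall i, psd (Om i)) (M3 : 3 <= M).

(** All that the replacement uses about a random vector: first, second and
    fourth moments of its linear functionals (M bounds the kurtosis) and a bound
    rho on the ratio of their third absolute moments to the power 3/2 of the
    variance. *)
Definition vec_moments (S : 'M[R]_m) (rho : R) (X : T -> 'cV[R]_m) : Prop :=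
  forall b, let v := dot b (S *m b) in
    centered4 P M v (fun w => dot b (X w)) /\
    (\int[P]_w (`|dot b (X w)| ^+ 3)%:E <= (rho * (v * Num.sqrt v))%:E)%E.

(** The mean of the conditional variance of dot S z_k given the slope S. *)
Definition slope_var (k : I) : R := \tr (Om k *m \sum_(j | j != k) a k j ^+ 2 *: Om j).

Lemma slope_three_halves_moment k (Z : I -> {RV P >-> 'cV[R]_m}) (rho : I -> R) :
  mutually_independent P Z -> (forall i, vec_moments (Om i) (rho i) (Z i)) ->
  let q w := dot (qform_slope k (Z ^~ w)) (Om k *m qform_slope k (Z ^~ w)) in
  [/\ 0 <= slope_var k, measurable_fun setT q & forall w, 0 <= q w] /\
  (\int[P]_w (q w * Num.sqrt (q w))%:E
    <= (Num.sqrt M * (slope_var k * Num.sqrt (slope_var k)))%:E)%E.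
Proof.
move=> ZI mZ; have M0 : 0 < M by rewrite (lt_le_trans _ M3).
apply: expect_quad_form_three_halves => // b.
have -> : dot b ((\sum_(j | j != k) a k j ^+ 2 *: Om j) *m b) =
    \sum_(j <- [seq j <- index_enum I | j != k]) a k j ^+ 2 * dot b (Om j *m b).
  rewrite big_filter mulmx_suml dot_sumr; apply: eq_bigr => j _.
  by rewrite -scalemxAl dotZr.
rewrite (_ : (fun w => _) = fun w =>
    \sum_(j <- [seq j <- index_enum I | j != k]) a k j * dot b (Z j w)); last first.
  apply/funext => w; rewrite big_filter dot_sumr; apply: eq_bigr => j _.
  by rewrite dotZr.
apply: (centered4_sum ZI (f := fun j z => a k j * dot b z)) => //.
- by rewrite filter_uniq// index_enum_uniq.
- move=> j; apply: measurable_funM => //.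
  by apply: measurable_dot => //; exact: measurable_cst.
- by move=> j; apply: centered4_scale; case: (mZ j b).
Qed.

(** Conditionally on slope and rest, the two families differ by a scalar variable
    only, whose mean and variance are the same for both; expect_taylor3 bounds
    the difference by third moments, which are then integrated over the slope. *)
Lemma lindeberg_step k (Z Z' : I -> {RV P >-> 'cV[R]_m}) (rho rho' : I -> R)
    (f : R -> R) (K : R) :
  mutually_independent P Z -> mutually_independent P Z' ->
  (forall i, i != k -> Z i = Z' i :> (T -> 'cV[R]_m)) ->
  (forall i, vec_moments (Om i) (rho i) (Z i)) ->
  (forall i, vec_moments (Om i) (rho' i) (Z' i)) ->
  test_function3 f -> (forall x, `|f x| <= K) -> 0 <= rho k + rho' k ->
  (\int[P]_w (f (qform (Z ^~ w)) + K)%:E <= \int[P]_w (f (qform (Z' ^~ w)) + K)%:E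
     + ((rho k + rho' k) / 6 * (Num.sqrt M * (slope_var k * Num.sqrt (slope_var k))))%:E)%E.
Proof.
move=> ZI ZI' ZZ' mZ mZ' ft fK rr.
have fK0 x : 0 <= f x + K by have := fK x; rewrite ler_norml => /andP[]; lra.
pose S w := qform_slope k (Z ^~ w); pose r w := qform_rest k (Z ^~ w).
pose q w := dot (S w) (Om k *m S w).
have [[V0 mq q0] qV] : [/\ 0 <= slope_var k, measurable_fun setT q & forall w, 0 <= q w] /\
    (\int[P]_w (q w * Num.sqrt (q w))%:E
      <= (Num.sqrt M * (slope_var k * Num.sqrt (slope_var k)))%:E)%E.
  exact: slope_three_halves_moment ZI mZ.
have S' w : qform_slope k (Z' ^~ w) = S w.
  by apply: eq_bigr => j jk; rewrite (ZZ' _ jk).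
have r' w : qform_rest k (Z' ^~ w) = r w.
  by congr (_ * _); apply: eq_bigr => i ik; apply: eq_bigr => j jk; rewrite !ZZ'.
pose h (z : 'cV[R]_m * ('cV[R]_m * R)) : \bar R := (f (z.2.2 + dot z.2.1 z.1) + K)%:E.
have mf : measurable_fun setT f.
  by case: ft => _ _ cf _; apply: continuous_measurable_fun; exact: (cf 0%N).
have mh : measurable_fun setT h.
  apply/measurable_EFinP; apply: measurable_funD => //.
  apply: (measurableT_comp mf); apply: measurable_funD.
    exact: (measurableT_comp measurable_snd measurable_snd).
  apply: measurable_dot => //.
  exact: (measurableT_comp measurable_fst measurable_snd).
have h0 z : (0 <= h z)%E by rewrite lee_fin.
have mY (Y : I -> {RV P >-> 'cV[R]_m}) : measurable_fun setT
    ((fun w => (qform_slope k (Y ^~ w), qform_rest k (Y ^~ w)))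
       : g_sigma_algebraType (cylinder_except Y k) -> 'cV[R]_m * R).
  apply: measurable_fun_pair.
    apply: (@measurable_qform_slope _ (g_sigma_algebraType (cylinder_except Y k)) k
      (fun j => Y j)) => j jk; exact: measurable_fun_except.
  apply: (@measurable_qform_rest _ (g_sigma_algebraType (cylinder_except Y k)) k
      (fun j => Y j)) => j jk; exact: measurable_fun_except.
have [mSr iSr] := mutually_independent_indep ZI (mY Z).
have [mSr' iSr'] := mutually_independent_indep ZI' (mY Z').
have mZk : measurable_fun setT (Z k) := measurable_funPT (Z k).
have mZk' : measurable_fun setT (Z' k) := measurable_funPT (Z' k).
under eq_integral do rewrite (qform_split k).
under [X in (_ <= X + _)%E]eq_integral do rewrite (qform_split k).
rewrite (indep_tonelli mZk mSr iSr mh h0) (indep_tonelli mZk' mSr' iSr' mh h0).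
rewrite /h/=.
under [X in (_ <= X + _)%E]eq_integral => w _ do under eq_integral do rewrite S' r'.
have c0 : 0 <= (rho k + rho' k) / 6 by lra.
have qq0 w : 0 <= q w * Num.sqrt (q w) by rewrite mulr_ge0.
have mqq : measurable_fun setT (fun w => (q w * Num.sqrt (q w))%:E).
  apply/measurable_EFinP; apply: measurable_funM => //.
  by apply: measurableT_comp mq; apply: continuous_measurable_fun; exact: sqrt_continuous.
have in1 : measurable_fun setT (fun w => \int[P]_w' (f (r w + dot (S w) (Z k w')) + K)%:E)%E.
  exact: measurable_inner_integral mZk mSr mh h0.
have in2 : measurable_fun setT (fun w => \int[P]_w' (f (r w + dot (S w) (Z' k w')) + K)%:E)%E.
  exact: measurable_inner_integral mZk' mSr mh h0.
apply: (@le_trans _ _ (\int[P]_w (\int[P]_w' (f (r w + dot (S w) (Z' k w')) + K)%:E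
    + ((rho k + rho' k) / 6)%:E * (q w * Num.sqrt (q w))%:E)))%E.
  apply: ge0_le_integral => //.
  - by move=> w _; apply: integral_ge0 => w' _; rewrite lee_fin.
  - by apply: emeasurable_funD => //; exact: measurable_funeM.
  - move=> w _; have [cZ tZ] := mZ k (S w); have [cZ' tZ'] := mZ' k (S w).
    have [iZ uZ _] := expect_taylor3 (r w) cZ tZ ft fK.
    have [iZ' _ lZ'] := expect_taylor3 (r w) cZ' tZ' ft fK.
    rewrite -EFinM EFin_Rintegral// EFin_Rintegral// -EFinD lee_fin.
    by rewrite (le_trans uZ)//; move: lZ'; rewrite -/(q w); lra.
rewrite ge0_integralD//; last 3 first.
- by move=> w _; apply: integral_ge0 => w' _; rewrite lee_fin.
- by move=> w _; rewrite -EFinM lee_fin mulr_ge0.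
- exact: measurable_funeM.
rewrite ge0_integralZl//; last by move=> w _; rewrite lee_fin.
by rewrite leeD2l// [leRHS]EFinM lee_wpmul2l// lee_fin.
Qed.

End lindeberg_step.

(** * Replacement of all vectors *)

Section hybrid.
Context d (T : measurableType d) (R : realType) (P : probability T R).
Context d' (V : measurableType d') (I : finType) (X Y : I -> {RV P >-> V}).

Definition hybrid (s : seq I) (i : I) : {RV P >-> V} := if i \in s then X i else Y i.

Lemma sigma_family_cylinder (Z : I -> {RV P >-> V}) (J : {set I}) (A : I -> set V) :
  (forall i, measurable (A i)) ->
  sigma_family Z (\bigcap_(i in [set i | i \in J]) Z i @^-1` A i).
Proof.
move=> mA; apply: (@fin_bigcap_measurable _ (g_sigma_algebraType
  (\bigcup_(i in [set: I]) preimage_set_system setT (Z i) measurable))) => // i _.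
by apply: sub_sigma_algebra; exists i => //; exists (A i) => //; rewrite setTI.
Qed.

Lemma hybrid_mutually_independent s : mutually_independent P X ->
  mutually_independent P Y -> independent_families P X Y ->
  mutually_independent P (hybrid s).
Proof.
move=> XI YI XY J A mA.
pose J1 : {set I} := [set i in J | i \in s]%SET.
pose J2 : {set I} := [set i in J | i \notin s]%SET.
have -> : \bigcap_(i in [set i | i \in J]) hybrid s i @^-1` A i =
    (\bigcap_(i in [set i | i \in J1]) X i @^-1` A i) `&`
    (\bigcap_(i in [set i | i \in J2]) Y i @^-1` A i).
  apply/seteqP; split => w.
    move=> h; split=> i /=; rewrite inE => /andP[iJ is_]; have := h i iJ;
      by rewrite /hybrid ?is_ ?(negbTE is_).
  move=> [h1 h2] i /= iJ; rewrite /hybrid; case: ifPn => is_.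
    by apply: h1; rewrite /= inE iJ.
  by apply: h2; rewrite /= inE iJ.
rewrite XY; [|exact: sigma_family_cylinder..].
rewrite XI// YI// [RHS](bigID (fun i => i \in s))/=; congr (_ * _)%E.
  rewrite (eq_bigl (fun i => (i \in J) && (i \in s))) => [|i]; last by rewrite inE.
  by apply: eq_bigr => i /andP[_ is_]; rewrite /hybrid is_.
rewrite (eq_bigl (fun i => (i \in J) && (i \notin s))) => [|i]; last by rewrite inE.
by apply: eq_bigr => i /andP[_ /negbTE is_]; rewrite /hybrid is_.
Qed.

End hybrid.

Section lindeberg.
Context d (T : measurableType d) (R : realType) (P : probability T R).
Context (m : nat) (I : finType) (a : I -> I -> R) (Om : I -> 'M[R]_m) (M : R).
Hypotheses (a_sym : forall i j, a i j = a j i) (a_diag : forall i, a i i = 0).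
Hypotheses (psdOm : forall i, psd (Om i)) (M3 : 3 <= M).

(** The vectors indexed by s come from X, the others from Y; enlarging s by one
    index at a time leads from Y to X. *)
Lemma lindeberg_replacement (X Y : I -> {RV P >-> 'cV[R]_m}) (rX rY : R)
    (f : R -> R) (K : R) :
  mutually_independent P X -> mutually_independent P Y -> independent_families P X Y ->
  (forall i, vec_moments P M (Om i) rX (X i)) ->
  (forall i, vec_moments P M (Om i) rY (Y i)) ->
  test_function3 f -> (forall x, `|f x| <= K) -> 0 <= rX + rY ->
  (\int[P]_w (f (qform a (X ^~ w)) + K)%:E <= \int[P]_w (f (qform a (Y ^~ w)) + K)%:E
     + ((rX + rY) / 6 * Num.sqrt M *
        \sum_k (slope_var a Om k * Num.sqrt (slope_var a Om k)))%:E)%E.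
Proof.
move=> XI YI XY mX mY ft fK rr.
pose Z s := hybrid X Y s.
have ZI s : mutually_independent P (Z s) by exact: hybrid_mutually_independent.
have mZ s i : vec_moments P M (Om i) (if i \in s then rX else rY) (Z s i).
  by rewrite /Z /hybrid; case: ifP.
suff partial s : uniq s ->
    (\int[P]_w (f (qform a (Z s ^~ w)) + K)%:E <= \int[P]_w (f (qform a (Y ^~ w)) + K)%:E
     + ((rX + rY) / 6 * Num.sqrt M *
        \sum_(k <- s) (slope_var a Om k * Num.sqrt (slope_var a Om k)))%:E)%E.
  have := partial (index_enum I) (index_enum_uniq I).
  congr (_ <= _)%E; apply: eq_integral => w _; congr (f (qform a _) + K)%:E.
  by apply/funext => i; rewrite /Z /hybrid mem_index_enum.
elim: s => [_|k s IH /= /andP[ks us]].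
  rewrite big_nil mulr0 adde0 le_eqVlt; apply/orP; left; apply/eqP.
  by apply: eq_integral => w _.
have step := @lindeberg_step _ _ _ P m I a a_sym a_diag Om M psdOm M3 k (Z (k :: s)) (Z s)
  _ _ f K (ZI _) (ZI _) _ (mZ _) (mZ _) ft fK.
apply: (le_trans (step _ _)) => [i ik||].
- by rewrite /Z /hybrid inE (negbTE ik).
- by rewrite mem_head (negbTE ks).
rewrite mem_head (negbTE ks) big_cons mulrDr EFinD addeCA [leRHS]addeC.
by apply: leeD; [exact: IH|rewrite !mulrA].
Qed.

End lindeberg.

(** * Integrals against a difference of laws *)

Section law_difference.
Context d (T : measurableType d) (R : realType) (P : probability T R).

Lemma integrable_bounded (mu : {finite_measure set R -> \bar R}) (f : R -> R) (K : R) :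
  measurable_fun setT f -> (forall x, `|f x| <= K) -> mu.-integrable setT (EFin \o f).
Proof.
move=> mf fK; apply: (@le_integrable _ _ _ mu setT measurableT _ (cst K%:E)) => //.
- exact/measurable_EFinP.
- by move=> x _; rewrite /= lee_fin (le_trans (fK x))// ler_norm.
- exact: (finite_measure_integrable_cst mu).
Qed.

(** If j+ and j- are the Jordan parts of nu = L(X) - L(Y), the measures
    j+ + L(Y) and j- + L(X) coincide, and so do the integrals of f. *)
Lemma charge_integral_law_diff (X Y : {RV P >-> R}) (f : R -> R) (K : R) :
  measurable_fun setT f -> (forall x, `|f x| <= K) ->
  (charge_integral (law_diff P X Y) f =
   \int[P]_w (f (X w))%:E - \int[P]_w (f (Y w))%:E)%E.
Proof.
move=> mf fK; rewrite /charge_integral.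
set nu := law_diff P X Y.
set jp := jordan_pos _; set jn := jordan_neg _.
have mf' : measurable_fun setT (EFin \o f) by exact/measurable_EFinP.
have ifin (mu : {finite_measure set R -> \bar R}) := @integrable_bounded mu f K mf fK.
have PE (Z : {RV P >-> R}) : (\int[P]_w (f (Z w))%:E = \int[distribution P Z]_x (f x)%:E)%E.
  rewrite integral_distribution//.
  apply: (@integrable_of_le _ _ _ _ _ (fun=> K)) => [||]; last exact: integrable_cst.
    by apply: (measurableT_comp mf); exact: measurable_funPT.
  by move=> w; exact: fK.
rewrite !PE.
have sumA A : measurable A -> (jp A + distribution P Y A = jn A + distribution P X A)%E.
  move=> mA; have := jordan_decomp (hahnP nu) mA.
  have -> : nu A = (distribution P X A - distribution P Y A)%E by [].
  have -> : cadd (jordan_pos (hahnP nu)) (cscale (-1) (jordan_neg (hahnP nu))) A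
      = (jp A - jn A)%E by rewrite /cadd/= cscaleN1.
  have /fineK <- : jp A \is a fin_num by exact: fin_num_measure.
  have /fineK <- : jn A \is a fin_num by exact: fin_num_measure.
  have /fineK <- : distribution P X A \is a fin_num by exact: fin_num_measure.
  have /fineK <- : distribution P Y A \is a fin_num by exact: fin_num_measure.
  by rewrite -!EFinB -!EFinD => -[h]; congr EFin; lra.
have sumE : (\int[jp]_x (f x)%:E + \int[distribution P Y]_x (f x)%:E =
             \int[jn]_x (f x)%:E + \int[distribution P X]_x (f x)%:E)%E.
  rewrite -!integral_measure_add//; try exact: ifin.
  apply: eq_measure_integral => A mA _.
  exact: (etrans (measure_addE _ _ A) (etrans (sumA A mA) (esym (measure_addE _ _ A)))).
have fin (mu : {finite_measure set R -> \bar R}) : (\int[mu]_x (f x)%:E)%E \is a fin_num.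
  by apply: integrable_fin_num => //; exact: ifin.
move: sumE.
have /fineK <- := fin (jordan_pos (hahnP nu)).
have /fineK <- := fin (jordan_neg (hahnP nu)).
have /fineK <- := fin (distribution P X).
have /fineK <- := fin (distribution P Y).
by rewrite -!EFinB -!EFinD => -[h]; congr EFin; lra.
Qed.

End law_difference.

(** * Moments of linear functionals *)

Section covariance_moments.
Context d (T : measurableType d) (R : realType) (P : probability T R).

Lemma Rintegral_sum (I : Type) (s : seq I) (f : I -> T -> R) :
  (forall i, P.-integrable setT (EFin \o f i)) ->
  P.-integrable setT (EFin \o (fun w => \sum_(i <- s) f i w)) /\
  \int[P]_w \sum_(i <- s) f i w = \sum_(i <- s) \int[P]_w f i w.
Proof.
move=> fi; elim: s => [|i s [IHi IH]].
  rewrite big_nil (_ : (fun w => _) = fun=> 0); last by apply/funext => w; rewrite big_nil.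
  by split; [exact: integrable_cst|exact: Rintegral_prob_cst].
rewrite big_cons (_ : (fun w => _) = fun w => f i w + \sum_(j <- s) f j w); last first.
  by apply/funext => w; rewrite big_cons.
by split; [exact: integrableRD|rewrite RintegralD// IH].
Qed.

Section centered_vector.
Context (m : nat) (X : {RV P >-> 'cV[R]_m}) (Om : 'M[R]_m).
Hypotheses (X0 : forall k, ('E_P[(fun w => X w k 0)%R] = 0)%E) (XOm : has_cov P X Om).

Lemma integrable_entry k : P.-integrable setT (EFin \o (fun w => X w k 0)).
Proof.
by apply/Lfun1_integrable/Lfun_subset12; [exact: fin_num_measure|exact: XOm.1].
Qed.

Lemma integrable_entryM k l : P.-integrable setT (EFin \o (fun w => X w k 0 * X w l 0)).
Proof. by apply/Lfun1_integrable/Lfun2_mul_Lfun1; exact: XOm.1. Qed.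

Lemma Rintegral_entryM k l : \int[P]_w (X w k 0 * X w l 0) = Om k l.
Proof.
have := XOm.2 k l; rewrite covarianceE ?X0 ?mule0 ?sube0; last first.
- by apply: Lfun2_mul_Lfun1; exact: XOm.1.
- by apply: Lfun_subset12; [exact: fin_num_measure|exact: XOm.1].
- by apply: Lfun_subset12; [exact: fin_num_measure|exact: XOm.1].
rewrite unlock => h; apply: EFin_inj; rewrite -h -EFin_Rintegral//.
exact: integrable_entryM.
Qed.

Lemma Rintegral_entry k : \int[P]_w X w k 0 = 0.
Proof. by have := X0 k; rewrite unlock /Rintegral => ->. Qed.

Lemma expect_dot b : P.-integrable setT (EFin \o (fun w => dot b (X w))) /\
  \int[P]_w dot b (X w) = 0.
Proof.
rewrite (_ : (fun w => _) = fun w => \sum_k b k 0 * X w k 0); last first.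
  by apply/funext => w; rewrite dotE.
have [|i1 ->] := @Rintegral_sum _ (index_enum 'I_m) (fun k w => b k 0 * X w k 0).
  by move=> k; apply: integrableRZ; exact: integrable_entry.
split=> //; rewrite big1// => k _; rewrite RintegralZl//; last exact: integrable_entry.
by rewrite Rintegral_entry mulr0.
Qed.

Lemma expect_dot_sqr b : P.-integrable setT (EFin \o (fun w => dot b (X w) ^+ 2)) /\
  \int[P]_w dot b (X w) ^+ 2 = dot b (Om *m b).
Proof.
rewrite (_ : (fun w => _) = fun w => \sum_k \sum_l b k 0 * b l 0 * (X w k 0 * X w l 0)); last first.
  apply/funext => w; rewrite dotE expr2 mulr_suml; apply: eq_bigr => k _.
  by rewrite mulr_sumr; apply: eq_bigr => l _; ring.
have inner k := @Rintegral_sum _ (index_enum 'I_m)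
  (fun l w => b k 0 * b l 0 * (X w k 0 * X w l 0))
  (fun l => integrableRZ _ (integrable_entryM k l)).
have [|i1 ->] := @Rintegral_sum _ (index_enum 'I_m)
    (fun k w => \sum_l b k 0 * b l 0 * (X w k 0 * X w l 0)).
  by move=> k; have [] := inner k.
split=> //; rewrite dotE; apply: eq_bigr => k _; have [_ ->] := inner k.
rewrite mxE mulr_sumr; apply: eq_bigr => l _.
rewrite RintegralZl//; last exact: integrable_entryM.
by rewrite Rintegral_entryM; ring.
Qed.

Lemma psd_cov : psd Om.
Proof.
split=> [|b].
  apply/matrixP => k l; rewrite mxE; apply: EFin_inj.
  by rewrite -!XOm.2 covarianceC.
by have [_ <-] := expect_dot_sqr b; apply: Rintegral_ge0 => w _; rewrite sqr_ge0.
Qed.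

(** The third moment comes from interpolation between the second and the fourth:
    E |t|^3 = E (t^2)^(3/2) <= sqrt (E t^2 * E t^4). *)
Lemma vec_moments_of_kurtosis (M gamma : R) : 1 < gamma -> gamma <= M ->
  (forall q (B : 'M[R]_(q, m)),
    ('E_P[fun w => (enorm (B *m X w) ^+ 4)%R]
       <= gamma%:E * 'E_P[fun w => (enorm (B *m X w) ^+ 2)%R] ^+ 2)%E) ->
  vec_moments P M Om (Num.sqrt gamma) X.
Proof.
move=> g1 gM kurt b; set v := dot b _.
have [i1 e1] := expect_dot b; have [i2 e2] := expect_dot_sqr b.
have mX : measurable_fun setT (fun w => dot b (X w)).
  by apply: measurable_dot; [exact: measurable_cst|exact: measurable_funPT].
have v0 : 0 <= v by have := psd_cov.2 b.
(* a linear functional is the case of a one-row matrix B *)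
have normE w : enorm (b^T *m X w) = `|dot b (X w)|.
  rewrite /enorm [X in Num.sqrt X](_ : _ = dot b (X w) ^+ 2) ?sqrtr_sqr//.
  by rewrite dotE big_ord1 -expr2.
have h4 : (\int[P]_w (dot b (X w) ^+ 4)%:E <= (gamma * v ^+ 2)%:E)%E.
  have := kurt 1%N b^T; rewrite unlock.
  under eq_integral do rewrite normE -normrX ger0_norm ?exprn_even_ge0//.
  under [X in (_ <= _ * X ^+ 2)%E]eq_integral do
    rewrite normE -normrX ger0_norm ?exprn_even_ge0//.
  by rewrite (EFin_Rintegral i2) e2 -/v -EFin_expe -EFinM.
split; first split => //.
  by rewrite (le_trans h4)// lee_fin ler_wpM2r// sqr_ge0.
under eq_integral => w _.
  rewrite (_ : `|dot b (X w)| ^+ 3 = dot b (X w) ^+ 2 * Num.sqrt (dot b (X w) ^+ 2)).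
    over.
  by rewrite sqrtr_sqr -[X in _ = X * _]ger0_norm ?sqr_ge0// normrX -exprSr.
apply: expect_three_halves_le => //; first exact: measurable_funX.
- by move=> w; rewrite sqr_ge0.
- by lra.
- by rewrite (EFin_Rintegral i2) e2.
- by under eq_integral do rewrite -exprM.
Qed.

End centered_vector.

End covariance_moments.

Section gaussian_moments.
Context d (T : measurableType d) (R : realType) (P : probability T R).
Context (m : nat) (X : {RV P >-> 'cV[R]_m}) (Om : 'M[R]_m).
Hypotheses (psdOm : psd Om) (XN : gaussian_vector P X 0 Om).

Let dotX b (w : T) := dot b (X w).

Let mdotX b : measurable_fun setT (dotX b).
Proof. by apply: measurable_dot; [exact: measurable_cst|exact: measurable_funPT]. Qed.

Let rvX b : {RV P >-> R} := HB.pack (dotX b) (isMeasurableFun.Build _ _ _ _ _ (mdotX b)).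

Lemma gaussian_dot_law b A : measurable A ->
  P (rvX b @^-1` A) = normal_law 0 (dot b (Om *m b)) A.
Proof. have d0 : dot b 0 = 0 by rewrite /dot mulmx0 mxE.
by move=> mA; have := XN b mA; rewrite d0. Qed.

Lemma gaussian_dot_moments b : let v := dot b (Om *m b) in
  [/\ (\int[P]_w (dot b (X w) ^+ 2)%:E = v%:E)%E,
      (\int[P]_w (dot b (X w) ^+ 4)%:E = (3 * v ^+ 2)%:E)%E &
      (\int[P]_w (`|dot b (X w)| ^+ 3)%:E = (Num.sqrt (8 / pi) * (v * Num.sqrt v))%:E)%E].
Proof.
move=> v; have v0 : 0 <= v := psdOm.2 b.
have [vz|vn0] := eqVneq v 0.
  have null (h : R -> R) : h 0 = 0 -> (forall x, 0 <= h x) -> measurable_fun setT h ->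
      (\int[P]_w (h (dot b (X w)))%:E = 0)%E.
    move=> hz h0 mh.
    have mh' : measurable_fun setT (EFin \o h) by exact/measurable_EFinP.
    transitivity (\int[distribution P (rvX b)]_x (h x)%:E)%E.
      by rewrite ge0_integral_distribution.
    transitivity (\int[\d_(0%R : R)]_x (h x)%:E)%E.
      apply: eq_measure_integral => A mA _.
      apply: (etrans (gaussian_dot_law b mA)).
      by rewrite /normal_law -/v vz eqxx.
    by rewrite integral_dirac//= hz mule0.
  rewrite vz expr0n/= mulr0 mul0r mulr0; split.
  - by apply: (null (fun x => x ^+ 2)); rewrite ?expr0n// => x; rewrite sqr_ge0.
  - by apply: (null (fun x => x ^+ 4)); rewrite ?expr0n// => x; rewrite exprn_even_ge0.
  - apply: (null (fun x => `|x| ^+ 3)); rewrite ?normr0 ?expr0n//.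
    by apply: measurable_funX; exact: normr_measurable.
have vp : 0 < v by rewrite lt0r vn0.
(* b = s b' where the functional b' has variance 1/2 *)
pose s := Num.sqrt (2 * v).
have s2 : s ^+ 2 = 2 * v by rewrite sqr_sqrtr// mulr_ge0.
have s0 : 0 < s by rewrite sqrtr_gt0 mulr_gt0.
pose b' := s^-1 *: b.
have XE w : dot b (X w) = s * rvX b' w.
  by rewrite /= /dotX /b' dotZl mulrA divff ?mul1r// gt_eqF.
have vb' : dot b' (Om *m b') = 1 / 2.
  rewrite /b' -scalemxAr dotZl dotZr (_ : dot b (Om *m b) = v)//.
  by rewrite mulrA -expr2 exprVn s2; field.
have law A : measurable A -> P (rvX b' @^-1` A) = normal_law 0 (1 / 2) A.
  by move=> mA; rewrite -vb'; exact: gaussian_dot_law.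
have m2 := normal_half_moment2 law; have m4 := normal_half_moment4 law.
have m3 := normal_half_abs_moment3 law.
have mb' : measurable_fun setT (rvX b') by exact: measurable_funPT.
split.
- under eq_integral do rewrite XE exprMn EFinM.
  rewrite ge0_integralZl//; last 3 first.
  + by apply/measurable_EFinP; exact: measurable_funX.
  + by move=> w _; rewrite lee_fin sqr_ge0.
  + by rewrite lee_fin sqr_ge0.
  by rewrite m2 -EFinM s2; congr EFin; field.
- under eq_integral do rewrite XE exprMn EFinM.
  rewrite ge0_integralZl//; last 3 first.
  + by apply/measurable_EFinP; exact: measurable_funX.
  + by move=> w _; rewrite lee_fin exprn_even_ge0.
  + by rewrite lee_fin exprn_even_ge0.
  rewrite m4 -EFinM (_ : s ^+ 4 = (s ^+ 2) ^+ 2); last by rewrite -exprM.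
  by rewrite s2; congr EFin; field.
- under eq_integral do rewrite XE normrM exprMn EFinM.
  rewrite ge0_integralZl//; last first.
    by apply/measurable_EFinP; apply: measurable_funX; exact: measurableT_comp.
  rewrite m3 -EFinM (gtr0_norm s0) exprS s2; congr EFin.
  have p0 := @pi_gt0 R.
  have -> : s = Num.sqrt 2 * Num.sqrt v by rewrite -sqrtrM.
  have -> : Num.sqrt (8 / pi) = 2 * Num.sqrt 2 / Num.sqrt pi :> R.
    rewrite (_ : 8 / pi = 2 ^+ 2 * (2 * pi^-1) :> R); last by ring.
    by rewrite sqrtrM ?sqr_ge0// sqrtr_sqr ger0_norm// sqrtrM// sqrtrV ?ltW// mulrA.
  by ring.
Qed.

(** A centred Gaussian functional is symmetric. *)
Lemma gaussian_dot_mean b : \int[P]_w dot b (X w) = 0.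
Proof.
have [e2 e4 _] := gaussian_dot_moments b.
have ib : P.-integrable setT (EFin \o rvX b).
  have e4' : (\int[P]_w (rvX b w ^+ 4)%:E <= (3 * dot b (Om *m b) ^+ 2)%:E)%E by rewrite -e4.
  have := integrable_pow4 (mdotX b) (isT : (1 <= 4)%N) e4'.
  by apply: eq_integrable => // w _; rewrite /= expr1.
have NE w : rvX (- b) w = - rvX b w by rewrite /= /dotX -scaleN1r dotZl mulN1r.
have ibN : P.-integrable setT (EFin \o rvX (- b)).
  rewrite (_ : _ \o _ = EFin \o (fun w => -1 * rvX b w)); first exact: integrableRZ.
  by apply/funext => w; apply: (congr1 EFin); rewrite mulN1r; exact: NE.
have lawE : (\int[P]_w (rvX b w)%:E = \int[P]_w (rvX (- b) w)%:E)%E.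
  rewrite -(@integral_distribution _ _ _ _ _ P (rvX b) EFin)//.
  rewrite -(@integral_distribution _ _ _ _ _ P (rvX (- b)) EFin)//.
  apply: eq_measure_integral => A mA _.
  apply: (etrans (gaussian_dot_law b mA)).
  apply: etrans (esym (gaussian_dot_law (- b) mA)); congr (normal_law _ _ _).
  by rewrite -scaleN1r -scalemxAr dotZl dotZr; ring.
have := congr1 fine lawE; rewrite -/(Rintegral P setT (rvX b)) -/(Rintegral P setT (rvX (- b))).
rewrite [RHS](_ : _ = - Rintegral P setT (rvX b)); last first.
  rewrite -mulN1r -RintegralZl//; apply: eq_Rintegral => w _.
  by rewrite mulN1r; exact: NE.
by rewrite /Rintegral/=; lra.
Qed.

Lemma vec_moments_gaussian (M : R) : 3 <= M -> vec_moments P M Om (Num.sqrt (8 / pi)) X.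
Proof.
move=> M3 b v; have [e2 e4 e3] := gaussian_dot_moments b; split; last by rewrite e3.
split.
- exact: mdotX.
- by rewrite e4 lee_fin ler_wpM2r// sqr_ge0.
- exact: gaussian_dot_mean.
- by rewrite /Rintegral e2.
Qed.

End gaussian_moments.

(** * The statistic as a quadratic form *)

Section transformed_families.
Context d (T : measurableType d) (R : realType) (P : probability T R).

Lemma mutually_independent_comp d1 d2 (V1 : measurableType d1) (V2 : measurableType d2)
    (I : finType) (X : I -> {RV P >-> V1}) (Y : I -> {RV P >-> V2}) (f : I -> V1 -> V2) :
  (forall i, measurable_fun setT (f i)) -> (forall i w, Y i w = f i (X i w)) ->
  mutually_independent P X -> mutually_independent P Y.
Proof.
move=> mf YE XI J A mA.
have YA i : Y i @^-1` A i = X i @^-1` (f i @^-1` A i).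
  by apply/seteqP; split => w; rewrite /preimage/= YE.
under [RHS]eq_bigr do rewrite YA.
rewrite -XI; first by congr (P _); apply: eq_bigcapr => i _; exact: YA.
by move=> i; rewrite -[X in measurable X]setTI; exact: mf.
Qed.

(** The map turning the observation y into udev S y, so that udev S inherits
    independence from y. *)
Definition udev_fun p (S : 'M[R]_p) (x : 'cV[R]_p) : 'cV[R]_(p * p) :=
  vec (x *m x^T) - vec S.

Lemma udev_funE p (S : 'M[R]_p) (x : 'cV[R]_p) a b :
  udev_fun S x (mxvec_index a b) 0 = x b 0 * x a 0 - S b a.
Proof. by rewrite /udev_fun /vec !mxE !mxvecE !mxE big_ord1 !mxE. Qed.

Lemma measurable_udev_fun p (S : 'M[R]_p) : measurable_fun setT (udev_fun S).
Proof.
apply: measurable_matrixP => k j; rewrite ord1; case/mxvec_indexP: k => a b.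
under eq_fun do rewrite udev_funE.
by apply: measurable_funB => //; apply: measurable_funM; exact: measurable_entry.
Qed.

Lemma udev_mean0 p (S : 'M[R]_p) (y : {RV P >-> 'cV[R]_p}) :
  has_mean P y 0 -> has_cov P y S ->
  forall k, ('E_P[(fun w => udev S y w k 0)%R] = 0)%E.
Proof.
move=> ym yS k; case/mxvec_indexP: k => a b.
have y0 c : ('E_P[(fun w => y w c 0)%R] = 0)%E by have [_ ->] := ym c; rewrite mxE.
rewrite unlock; under eq_integral do rewrite (udev_funE S (y _)).
have iM := integrable_entryM yS b a.
rewrite (EFin_Rintegral (X := fun w => y w b 0 * y w a 0 - S b a)); last first.
  apply: (integrableRD (X := fun w => y w b 0 * y w a 0) (q := fun=> - S b a)) => //.
  exact: integrable_cst.
rewrite RintegralB//; last exact: integrable_cst.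
by rewrite (Rintegral_entryM y0 yS) Rintegral_prob_cst subrr.
Qed.

End transformed_families.

Section pooled_statistic.
Context {R : realType} (m n1 n2 : nat).

Lemma sum_neq_double n (F : 'I_n -> 'I_n -> R) : (forall i j, F i j = F j i) ->
  \sum_i \sum_j (if i == j then 0 else F i j) =
  2 * \sum_(i < n) \sum_(j < n | (i < j)%N) F i j.
Proof.
move=> Fs; have -> : \sum_i \sum_j (if i == j then 0 else F i j) =
    \sum_(i < n) \sum_(j < n | (i < j)%N) F i j + \sum_(i < n) \sum_(j < n | (j < i)%N) F i j.
  rewrite -big_split/=; apply: eq_bigr => i _.
  rewrite [in X in _ = X + _]big_mkcond [in X in _ = _ + X]big_mkcond -big_split/=.
  by apply: eq_bigr => j _; rewrite -val_eqE/=; case: ltngtP; rewrite ?addr0 ?add0r.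
rewrite [X in _ + X](_ : _ = \sum_(i < n) \sum_(j < n | (i < j)%N) F i j); first by ring.
rewrite (exchange_big_dep xpredT)//=; apply: eq_bigr => i _.
by apply: eq_bigr => j _.
Qed.

Context (sg : R).

(** Coefficients of Qstat / sg as a quadratic form in the pooled sample. *)
Definition pool_weight (k l : 'I_n1 + 'I_n2) : R :=
  match k, l with
  | inl i, inl j => if i == j then 0 else 2 / (n1%:R * (n1%:R - 1)) / sg
  | inr i, inr j => if i == j then 0 else 2 / (n2%:R * (n2%:R - 1)) / sg
  | _, _ => - (2 / (n1%:R * n2%:R)) / sg
  end.

Lemma pool_weight_sym k l : pool_weight k l = pool_weight l k.
Proof. by case: k l => [i|i] [j|j] //=; rewrite eq_sym. Qed.

Lemma pool_weight_diag k : pool_weight k k = 0.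
Proof. by case: k => i /=; rewrite eqxx. Qed.

Lemma Qstat_qform (z1 : 'I_n1 -> 'cV[R]_m) (z2 : 'I_n2 -> 'cV[R]_m) :
  Qstat z1 z2 / sg =
  qform pool_weight (fun k => match k with inl i => z1 i | inr j => z2 j end).
Proof.
rewrite /qform big_sumType/=.
under eq_bigr do rewrite big_sumType/=.
under [X in _ * (_ + X)]eq_bigr do rewrite big_sumType/=.
rewrite !big_split/= /Qstat.
set c1 := 2 / _; set c2 := 2 / (n2%:R * _); set c3 := 2 / _.
have half n (z : 'I_n -> 'cV[R]_m) c :
    \sum_i \sum_j (if i == j then 0 else c / sg) * dot (z i) (z j) =
    2 * (c / sg) * \sum_(i < n) \sum_(j < n | (i < j)%N) dot (z i) (z j).
  have sumE : c / sg * \sum_(i < n) \sum_(j < n | (i < j)%N) dot (z i) (z j) =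
      \sum_(i < n) \sum_(j < n | (i < j)%N) c / sg * dot (z i) (z j).
    by rewrite mulr_sumr; apply: eq_bigr => i _; rewrite mulr_sumr.
  rewrite -[RHS]mulrA sumE.
  rewrite -sum_neq_double; last by move=> i j; rewrite dotC.
  by apply: eq_bigr => i _; apply: eq_bigr => j _; case: eqP; rewrite ?mul0r.
rewrite !half.
have -> : \sum_i \sum_j - c3 / sg * dot (z1 i) (z2 j) =
    - c3 / sg * \sum_(i < n1) \sum_(j < n2) dot (z1 i) (z2 j).
  by rewrite mulr_sumr; apply: eq_bigr => i _; rewrite mulr_sumr.
have -> : \sum_i \sum_j - c3 / sg * dot (z2 i) (z1 j) =
    - c3 / sg * \sum_(i < n1) \sum_(j < n2) dot (z1 i) (z2 j).
  rewrite exchange_big mulr_sumr; apply: eq_bigr => i _; rewrite mulr_sumr.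
  by apply: eq_bigr => j _; rewrite dotC.
by move: (sg^-1) => s; field.
Qed.

End pooled_statistic.

(** * Slope variances and the final constant *)

Section slope_variances.
Context {R : realType} (m n1 n2 : nat) (O1 O2 : 'M[R]_m) (sg : R).
Local Notation a := (@pool_weight R n1 n2 sg).

Definition pool_cov (k : 'I_n1 + 'I_n2) : 'M[R]_m :=
  match k with inl _ => O1 | inr _ => O2 end.

Lemma slope_varE (k : 'I_n1 + 'I_n2) :
  slope_var a pool_cov k = \sum_l a k l ^+ 2 * \tr (pool_cov k *m pool_cov l).
Proof.
rewrite /slope_var mulmx_sumr raddf_sum/= [RHS](bigD1 k)//= pool_weight_diag.
rewrite expr0n/= mul0r add0r; apply: eq_bigr => l _.
by rewrite -scalemxAr mxtraceZ.
Qed.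

Lemma sum_neq_const n (i : 'I_n) (c t : R) :
  \sum_j (if i == j then 0 else c) ^+ 2 * t = (n%:R - 1) * (c ^+ 2 * t).
Proof.
rewrite (bigD1 i)//= eqxx expr0n/= mul0r add0r.
rewrite (eq_bigr (fun=> c ^+ 2 * t)) => [|j ji]; last by rewrite eq_sym (negbTE ji).
rewrite sumr_const cardC1 card_ord -[LHS]mulr_natl; congr (_ * _).
by case: n i {c t} => [[]//|n _]; rewrite -natr1 addrK.
Qed.

Lemma slope_var_inl i : slope_var a pool_cov (inl i) =
  (n1%:R - 1) * ((2 / (n1%:R * (n1%:R - 1)) / sg) ^+ 2 * \tr (O1 *m O1)) +
  n2%:R * ((2 / (n1%:R * n2%:R) / sg) ^+ 2 * \tr (O1 *m O2)).
Proof.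
rewrite slope_varE big_sumType/= sum_neq_const sumr_const card_ord.
by rewrite mulNr sqrrN -(mulr_natl (_ * \tr _)).
Qed.

Lemma slope_var_inr i : slope_var a pool_cov (inr i) =
  (n2%:R - 1) * ((2 / (n2%:R * (n2%:R - 1)) / sg) ^+ 2 * \tr (O2 *m O2)) +
  n1%:R * ((2 / (n1%:R * n2%:R) / sg) ^+ 2 * \tr (O1 *m O2)).
Proof.
rewrite slope_varE big_sumType/= sum_neq_const sumr_const card_ord.
by rewrite mulNr sqrrN -(mulr_natl (_ * \tr _)) (mxtrace_mulC O2 O1) addrC.
Qed.

(** Every product of two vectors enters the slopes of both, so the slope
    variances of the standardized statistic add up to twice its variance 1. *)
Lemma slope_var_total (i1 : 'I_n1) (i2 : 'I_n2) : (1 < n1)%N -> (1 < n2)%N ->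
  sg = sigmaT n1 n2 O1 O2 -> 0 < sg ->
  n1%:R * slope_var a pool_cov (inl i1) + n2%:R * slope_var a pool_cov (inr i2) = 2.
Proof.
move=> n1_gt1 n2_gt1 sgE sg0; rewrite slope_var_inl slope_var_inr.
have sg2 : sg ^+ 2 = 2 * (\tr (O1 *m O1) / (n1%:R * (n1%:R - 1))
   + 2 * \tr (O1 *m O2) / (n1%:R * n2%:R) + \tr (O2 *m O2) / (n2%:R * (n2%:R - 1))).
  by rewrite sgE sqr_sqrtr// ltW// -sqrtr_gt0 -/(sigmaT _ _ _ _) -sgE.
have a0 : n1%:R != 0 :> R by rewrite pnatr_eq0 -lt0n ltnW.
have b0 : n2%:R != 0 :> R by rewrite pnatr_eq0 -lt0n ltnW.
have a1 : n1%:R - 1 != 0 :> R by rewrite subr_eq0 pnatr_eq1 gt_eqF.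
have b1 : n2%:R - 1 != 0 :> R by rewrite subr_eq0 pnatr_eq1 gt_eqF.
have s0 : sg != 0 by rewrite gt_eqF.
transitivity (2 * sg ^+ 2 / sg ^+ 2); last by rewrite mulfK// sqrf_eq0.
by rewrite [X in _ = 2 * X / _]sg2; field; rewrite s0 a0 b0 a1 b1.
Qed.

(** As n1 V1 <= 2, sqrt V1 <= sqrt (2 / n1), and likewise for V2. *)
Lemma sum_three_halves_le (V1 V2 : R) : (0 < n1)%N -> (0 < n2)%N ->
  0 <= V1 -> 0 <= V2 -> n1%:R * V1 + n2%:R * V2 = 2 ->
  n1%:R * (V1 * Num.sqrt V1) + n2%:R * (V2 * Num.sqrt V2)
    <= 2 * Num.sqrt 2 * Num.sqrt (n1%:R^-1 + n2%:R^-1).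
Proof.
move=> n10 n20 V10 V20 V12.
have a0 : 0 < n1%:R :> R by rewrite ltr0n.
have b0 : 0 < n2%:R :> R by rewrite ltr0n.
set s := n1%:R^-1 + n2%:R^-1.
have ai : 0 < n1%:R^-1 :> R by rewrite invr_gt0.
have bi : 0 < n2%:R^-1 :> R by rewrite invr_gt0.
have aV : 0 <= n1%:R * V1 by rewrite mulr_ge0// ltW.
have bV : 0 <= n2%:R * V2 by rewrite mulr_ge0// ltW.
have V1s : V1 <= 2 * s.
  have : V1 <= 2 * n1%:R^-1 by rewrite ler_pdivlMr// mulrC; lra.
  by rewrite /s; lra.
have V2s : V2 <= 2 * s.
  have : V2 <= 2 * n2%:R^-1 by rewrite ler_pdivlMr// mulrC; lra.
  by rewrite /s; lra.
rewrite -mulrA -sqrtrM// -[X in _ <= X * _]V12 mulrDl !mulrA.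
by apply: lerD; apply: ler_wpM2l => //; exact: ler_wsqrtr.
Qed.

End slope_variances.

Section powers.
Context {R : realType}.

Lemma bound_powR (g s : R) : 0 < g -> 0 <= s ->
  (2 * g) `^ (3 / 2) / 3 `^ (1 / 4) * s `^ (1 / 2) =
  Num.sqrt g ^+ 3 / Num.sqrt (Num.sqrt 3) * (2 * Num.sqrt 2 * Num.sqrt s).
Proof.
move=> g0 s0.
have h (x : R) : 0 <= x -> x `^ (1 / 2) = Num.sqrt x.
  by move=> x0; rewrite mul1r powR12_sqrt.
have -> : (2 * g) `^ (3 / 2) = 2 * g * Num.sqrt (2 * g).
  rewrite (_ : 3 / 2 = 1 + 1 / 2 :> R); last by field.
  rewrite powRD; last by apply/implyP => _; rewrite gt_eqF// mulr_gt0.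
  by rewrite powRr1 ?h ?mulr_ge0// ltW.
have -> : 3 `^ (1 / 4) = Num.sqrt (Num.sqrt 3) :> R.
  rewrite (_ : 1 / 4 = 1 / 2 * (1 / 2) :> R); last by field.
  by rewrite powRrM !h// sqrtr_ge0.
rewrite h// sqrtrM// exprS sqr_sqrtr ?(ltW g0)//.
by ring.
Qed.

End powers.

(** * The Gaussian comparison *)

Theorem theorem1 (R : realType) (d : measure_display) (T : measurableType d)
    (P : probability T R) (p n1 n2 : nat)
    (y1 : 'I_n1 -> {RV P >-> 'cV[R]_p}) (y2 : 'I_n2 -> {RV P >-> 'cV[R]_p})
    (Sigma1 Sigma2 : 'M[R]_p) (Omega1 Omega2 : 'M[R]_(p * p))
    (ustar1 : 'I_n1 -> {RV P >-> 'cV[R]_(p * p)})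
    (ustar2 : 'I_n2 -> {RV P >-> 'cV[R]_(p * p)})
    (gamma : R) :
  let u1 : 'I_n1 -> {RV P >-> 'cV[R]_(p * p)} := fun j => udev Sigma1 (y1 j) in
  let u2 : 'I_n2 -> {RV P >-> 'cV[R]_(p * p)} := fun j => udev Sigma2 (y2 j) in
  (2 < n1)%N -> (2 < n2)%N ->
  mutually_independent P (pool y1 y2) ->
  identically_distributed P y1 -> identically_distributed P y2 ->
  (forall j, has_mean P (y1 j) 0) -> (forall j, has_mean P (y2 j) 0) ->
  (forall j, has_cov P (y1 j) Sigma1) -> (forall j, has_cov P (y2 j) Sigma2) ->
  (forall j, has_cov P (u1 j) Omega1) -> (forall j, has_cov P (u2 j) Omega2) ->
  mutually_independent P (pool ustar1 ustar2) ->
  independent_families P (pool u1 u2) (pool ustar1 ustar2) ->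
  (forall j, gaussian_vector P (ustar1 j) 0 Omega1) ->
  (forall j, gaussian_vector P (ustar2 j) 0 Omega2) ->
  0 < sigmaT n1 n2 Omega1 Omega2 ->
  1 < gamma ->
  (forall (q : nat) (B : 'M[R]_(q, p * p)),
    (forall j, 'E_P[fun w => (enorm (B *m u1 j w) ^+ 4)%R]
       <= gamma%:E * 'E_P[fun w => (enorm (B *m u1 j w) ^+ 2)%R] ^+ 2)%E /\
    (forall j, 'E_P[fun w => (enorm (B *m u2 j w) ^+ 4)%R]
       <= gamma%:E * 'E_P[fun w => (enorm (B *m u2 j w) ^+ 2)%R] ^+ 2)%E) ->
  (norm3 (law_diff P (Tstd Omega1 Omega2 u1 u2)
                     (Tstd Omega1 Omega2 ustar1 ustar2))
   <= ((2 * gamma) `^ (3 / 2) / 3 `^ (1 / 4)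
       * (n1%:R^-1 + n2%:R^-1) `^ (1 / 2))%:E)%E.
Proof.
move=> u1 u2 n1_gt2 n2_gt2 yI _ _ ym1 ym2 yS1 yS2 uO1 uO2 usI uusI usG1 usG2 sg0 g1 kurt.
set sg := sigmaT n1 n2 Omega1 Omega2 in sg0 *.
pose a := @pool_weight R n1 n2 sg.
pose Om := @pool_cov R (p * p) n1 n2 Omega1 Omega2.
pose M := Num.max gamma 3.
have M3 : 3 <= M by rewrite le_max lexx orbT.
have gM : gamma <= M by rewrite le_max lexx.
have j1 : 'I_n1 := Ordinal (ltnW (ltnW n1_gt2)).
have j2 : 'I_n2 := Ordinal (ltnW (ltnW n2_gt2)).
have u1_0 j := udev_mean0 (ym1 j) (yS1 j).
have u2_0 j := udev_mean0 (ym2 j) (yS2 j).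
have psd1 : psd Omega1 := psd_cov (u1_0 j1) (uO1 j1).
have psd2 : psd Omega2 := psd_cov (u2_0 j2) (uO2 j2).
have psdOm k : psd (Om k) by case: k.
have uI : mutually_independent P (pool u1 u2).
  apply: (mutually_independent_comp (X := pool y1 y2)
    (f := fun k => match k with
      inl _ => udev_fun Sigma1 | inr _ => udev_fun Sigma2 end)) => //.
  - by case=> _; exact: measurable_udev_fun.
  - by case.
have mU k : vec_moments P M (Om k) (Num.sqrt gamma) (pool u1 u2 k).
  case: k => j /=.
    apply: (vec_moments_of_kurtosis (u1_0 j) (uO1 j)) => // q B.
    by have [h _] := kurt q B; exact: h.
  apply: (vec_moments_of_kurtosis (u2_0 j) (uO2 j)) => // q B.
  by have [_ h] := kurt q B; exact: h.
have mV k : vec_moments P M (Om k) (Num.sqrt (8 / pi)) (pool ustar1 ustar2 k).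
  by case: k => j /=; exact: vec_moments_gaussian.
have TE (U1 : 'I_n1 -> {RV P >-> 'cV[R]_(p * p)}) U2 w :
    Tstd Omega1 Omega2 U1 U2 w = qform a ((pool U1 U2) ^~ w).
  by rewrite /Tstd Qstat_qform; congr qform; apply/funext; case.
have V0 k : 0 <= slope_var a Om k.
  have [[]] := slope_three_halves_moment a psdOm M3 k (rho := fun=> Num.sqrt gamma) uI mU.
  by [].
(* the slope variance is constant on each sample *)
have Vsum : \sum_k slope_var a Om k * Num.sqrt (slope_var a Om k) <=
    2 * Num.sqrt 2 * Num.sqrt (n1%:R^-1 + n2%:R^-1).
  rewrite big_sumType/=.
  rewrite (eq_bigr (fun=> slope_var a Om (inl j1) * Num.sqrt (slope_var a Om (inl j1))));
    last first.
    by move=> i _; rewrite !slope_var_inl.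
  rewrite [X in _ + X](eq_bigr (fun=> slope_var a Om (inr j2) * Num.sqrt (slope_var a Om (inr j2))));
    last first.
    by move=> i _; rewrite !slope_var_inr.
  rewrite !sumr_const !card_ord -(mulr_natl (_ * _) n1) -(mulr_natl (_ * _) n2).
  apply: sum_three_halves_le => //; [exact: ltn_trans n1_gt2|exact: ltn_trans n2_gt2|].
  by apply: slope_var_total => //; exact: ltnW.
have c0 : 0 <= Num.sqrt gamma by [].
have c1 : 0 <= Num.sqrt (8 / pi) :> R by [].
have g0 : 0 < gamma by lra.
have s0 : 0 <= n1%:R^-1 + n2%:R^-1 :> R by rewrite addr_ge0// invr_ge0.
rewrite (bound_powR g0 s0).
apply: ub_ereal_sup => _ [f ft <-].
have [[K fK] _ cf _] := ft.
have mf : measurable_fun setT f by apply: continuous_measurable_fun; exact: (cf 0%N).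
rewrite (charge_integral_law_diff _ _ mf fK).
have := lindeberg_replacement (pool_weight_sym sg) (pool_weight_diag sg) psdOm M3 uI usI uusI
  mU mV ft fK (addr_ge0 c0 c1).
set X := Tstd Omega1 Omega2 u1 u2; set Y := Tstd Omega1 Omega2 ustar1 ustar2.
under eq_integral do rewrite -TE.
under [X in (_ <= X + _)%E]eq_integral do rewrite -TE.
have ifin (Z : {RV P >-> R}) : P.-integrable setT (EFin \o (fun w => f (Z w))).
  apply: (@integrable_of_le _ _ _ _ _ (fun=> K)) => [|w|]; last exact: integrable_cst.
    by apply: (measurableT_comp mf); exact: measurable_funPT.
  exact: fK.
have shift (Z : {RV P >-> R}) : (\int[P]_w (f (Z w) + K)%:E = (\int[P]_w f (Z w) + K)%:E)%E.
  rewrite EFin_Rintegral; last by apply: integrableRD => //; exact: integrable_cst.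
  by rewrite RintegralD// ?Rintegral_prob_cst//; exact: integrable_cst.
rewrite (shift X) (shift Y) (EFin_Rintegral (ifin X)) (EFin_Rintegral (ifin Y)).
rewrite -EFinD -EFinB !lee_fin => step.
(* w = sqrt (sqrt 3) is 3^(1/4), g = sqrt gamma *)
have w4 : Num.sqrt (Num.sqrt 3) ^+ 4 = 3 :> R.
  by rewrite (_ : 4%N = (2 * 2)%N)// exprM !sqr_sqrtr.
have w2 : Num.sqrt (Num.sqrt 3) ^+ 2 = Num.sqrt 3 :> R by rewrite sqr_sqrtr.
have sg1 : 1 <= Num.sqrt gamma by rewrite -sqrtr1 ler_wsqrtr// ltW.
have := lindeberg_constant sg1 (sqrtr_ge0 _) w4 c1 (@sqrt_8_over_pi_le R).
have -> : Num.max (Num.sqrt gamma) (Num.sqrt (Num.sqrt 3) ^+ 2) = Num.sqrt M.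
  rewrite w2 /M; have [g3|g3] := leP gamma 3.
    by rewrite (max_idPr _)// ler_wsqrtr.
  by rewrite (max_idPl _)// ler_wsqrtr// ltW.
set C := _ / 6 => Cle.
have stepC : \int[P]_w f (X w) - \int[P]_w f (Y w) <=
    C * \sum_k slope_var a Om k * Num.sqrt (slope_var a Om k).
  move: step; rewrite (_ : (_ + _) / 6 * Num.sqrt M = C); last by rewrite /C; field.
  by rewrite /a /Om; lra.
apply: (le_trans stepC); apply: ler_pM => //.
- by rewrite /C divr_ge0// mulr_ge0// ?addr_ge0.
- by apply: sumr_ge0 => k _; rewrite mulr_ge0.
Qed.
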